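(* Let $n,l\ge1$ and let $\phi_1,\dots,\phi_l\in C^\infty(\mathbb{R}^n\setminus\{0\})$ be real-valued functions, each homogeneous of the same degree $m\ge 2n$. Let $\Phi(x)=(\phi_1(x),\dots,\phi_l(x))$ and, for $\lambda=(\lambda_1,\dots,\lambda_l)\in\mathbb{R}^l$, let $\Phi_\lambda(x)=\langle\Phi(x),\lambda\rangle$. Let $\psi$ be a smooth cutoff function on $\mathbb{R}^n$ and for $\xi\in\mathbb{R}^n$, $\lambda\in\mathbb{R}^l$ put $$F(\xi,\lambda)=\int_{\mathbb{R}^n}e^{i\left(\langle x,\xi\rangle+\lambda_1\phi_1(x)+\cdots+\lambda_l\phi_l(x)\right)}\psi(x)\,dx.$$ Then there is a constant $C$, independent of $\xi$ and $\lambda$, such that $$|F(\xi,\lambda)|\le C\int_{S^{n-1}}|\Phi_\lambda(\omega)|^{-\frac{n}{m}}\,d\omega .$$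
   Context: Homogeneous of degree $m$ means $\phi(tx)=t^m\phi(x)$ for $t>0$, $x\ne0$ (and $\phi(0)=0$). A smooth cutoff function is a $C^\infty$ function with compact support. $d\omega$ is surface measure on the unit sphere $S^{n-1}$; the right-hand side is allowed to be $+\infty$. *)

(* Defs.v *)
From HB Require Import structures.
From mathcomp Require Import all_boot all_order all_algebra.
From mathcomp Require Import complex.
From mathcomp Require Import all_classical all_reals all_analysis.
From mathcomp Require Import measurable_realfun.

Set Implicit Arguments.
Unset Strict Implicit.
Unset Printing Implicit Defensive.
Import Order.TTheory GRing.Theory Num.Theory.
Import numFieldNormedType.Exports.

Local Open Scope classical_set_scope.
Local Open Scope ring_scope.

Definition measure_rV_display : measure_display.
Proof. exact: default_measure_display. Qed.

(* The product sigma-algebra on R^n, as the library does for n.-tuple; it is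
   the Borel sigma-algebra of R^n. *)
Section measurable_rV.
Context {R : realType} {n : nat}.

Let coord (i : 'I_n) (x : 'rV[R]_n) : measurableTypeR R := x ord0 i.

Let rV_set0 : g_sigma_preimage coord set0.
Proof. exact: sigma_algebra0. Qed.

Let rV_setC A : g_sigma_preimage coord A -> g_sigma_preimage coord (~` A).
Proof. exact: sigma_algebraC. Qed.

Let rV_bigcup (F : _^nat) : (forall i, g_sigma_preimage coord (F i)) ->
  g_sigma_preimage coord (\bigcup_i (F i)).
Proof. exact: sigma_algebra_bigcup. Qed.

HB.instance Definition _ := @isMeasurable.Build measure_rV_display
  'rV[R]_n (g_sigma_preimage coord) rV_set0 rV_setC rV_bigcup.

Lemma measurable_coord (i : 'I_n) :
  measurable_fun [set: 'rV[R]_n] (fun x => x ord0 i).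
Proof.
move=> _ Y mY; rewrite setTI; apply: sub_sigma_algebra => /=.
rewrite -bigcup_seq/=; exists i => /=; first by rewrite mem_index_enum.
by exists Y => //; rewrite setTI.
Qed.

Lemma measurable_fun_rVP d (T : measurableType d) (f : T -> 'rV[R]_n) :
  (forall i, measurable_fun [set: T] (fun t => f t ord0 i)) ->
  measurable_fun [set: T] f.
Proof.
move=> mf _ A mA; rewrite setTI.
have sub : measurable `<=` [set A : set 'rV[R]_n | measurable (f @^-1` A)].
  apply: smallest_sub.
    split => /=; first by rewrite preimage_set0.
      by move=> B mB; rewrite setTD preimage_setC; exact: measurableC.
    move=> F mF; rewrite preimage_bigcup; exact: bigcupT_measurable.
  move=> B; rewrite -bigcup_seq/= => -[i _ [C mC <-]].
  by rewrite setTI -[X in measurable X]setTI; exact: (mf i).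
exact: sub mA.
Qed.

End measurable_rV.

Lemma product_sigma_finite {d1 d2 : measure_display} {T1 : measurableType d1}
    {T2 : measurableType d2} {R : realType}
    (m1 : {sigma_finite_measure set T1 -> \bar R})
    (m2 : {sigma_finite_measure set T2 -> \bar R}) :
  sigma_finite setT (m1 \x m2)%E.
Proof.
have /sigma_finiteP[F [TF ndF Foo]] := sigma_finiteT m1.
have /sigma_finiteP[G [TG ndG Goo]] := sigma_finiteT m2.
exists (fun n => F n `*` G n).
  rewrite -setXTT TF TG predeqE => -[x y]; split.
    move=> [/= [n _ Fnx] [k _ Gky]]; exists (maxn n k) => //; split.
    - by move: x Fnx; exact/subsetPset/ndF/leq_maxl.
    - by move: y Gky; exact/subsetPset/ndG/leq_maxr.
  by move=> [n _ []/= ? ?]; split; exists n.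
move=> k; have [? ?] := Foo k; have [? ?] := Goo k.
split; first exact: measurableX.
by rewrite product_measure1E// lte_mul_pinfty// ge0_fin_numE.
Qed.

Section lebesgue_rV.
Context {R : realType}.

Definition rV_cons n (p : measurableTypeR R * 'rV[R]_n) : 'rV[R]_n.+1 :=
  row_mx (p.1 : R)%:M p.2.

Definition rV_uncons n (x : 'rV[R]_n.+1) : measurableTypeR R * 'rV[R]_n :=
  (x ord0 ord0, \row_i x ord0 (lift ord0 i)).

Lemma rV_cons0 n (p : measurableTypeR R * 'rV[R]_n) :
  rV_cons p ord0 ord0 = p.1.
Proof.
have -> : @ord0 n = lshift n (@ord0 0) by exact/val_inj.
by apply: etrans (row_mxEl _ _ _ _) _; rewrite mxE eqxx mulr1n.
Qed.

Lemma rV_consS n (p : measurableTypeR R * 'rV[R]_n) i :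
  rV_cons p ord0 (lift ord0 i) = p.2 ord0 i.
Proof.
have -> : lift ord0 i = rshift 1 i by exact/val_inj.
exact: row_mxEr.
Qed.

Lemma rV_consK n : cancel (@rV_cons n) (@rV_uncons n).
Proof.
move=> [a x]; rewrite /rV_uncons rV_cons0; congr pair.
by apply/rowP => i; rewrite mxE rV_consS.
Qed.

Lemma measurable_rV_cons n : measurable_fun setT (@rV_cons n).
Proof.
apply: measurable_fun_rVP => i; case: (unliftP ord0 i) => [j|] ->.
  under eq_fun do rewrite rV_consS.
  exact: (measurableT_comp (measurable_coord j) measurable_snd).
by under eq_fun do rewrite rV_cons0; exact: measurable_fst.
Qed.

Lemma measurable_rV_uncons n : measurable_fun setT (@rV_uncons n).
Proof.
apply/measurable_fun_pairP; split; first exact: measurable_coord.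
apply: measurable_fun_rVP => i /=; under eq_fun do rewrite mxE.
exact: measurable_coord.
Qed.

(* Lebesgue measure on R^n, as the iterated product measure. *)
Fixpoint lebesgue_rV n : set 'rV[R]_n -> \bar R :=
  if n is n'.+1
  then pushforward (lebesgue_measure \x @lebesgue_rV n')%E (@rV_cons n')
  else @dirac _ 'rV[R]_0 0 R.

Section step.
Variables (n : nat) (mu : {sigma_finite_measure set 'rV[R]_n -> \bar R}).

Let step := pushforward (@lebesgue_measure R \x mu)%E (@rV_cons n).

Let step_measure : {measure set 'rV[R]_n.+1 -> \bar R} :=
  measure_function_pushforward__canonical__measure_function_Measure
    (@lebesgue_measure R \x mu)%E (@measurable_rV_cons n).

Let step0 : step set0 = 0%E. Proof. exact: (measure0 step_measure). Qed.

Let step_ge0 A : (0 <= step A)%E.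
Proof. exact: (measure_ge0 step_measure). Qed.

Let step_sigma_additive : semi_sigma_additive step.
Proof. exact: (@measure_semi_sigma_additive _ _ _ step_measure). Qed.

HB.instance Definition _ := isMeasure.Build _ _ _ step
  step0 step_ge0 step_sigma_additive.

Let step_sigma_finite : sigma_finite setT step.
Proof.
have [F FT mF] := product_sigma_finite (@lebesgue_measure R) mu.
exists (fun k => @rV_uncons n @^-1` F k).
  by rewrite -preimage_bigcup -FT preimage_setT.
move=> k; split.
  rewrite -[X in measurable X]setTI; apply: measurable_rV_uncons => //.
  exact: (mF k).1.
rewrite /step /pushforward -comp_preimage.
rewrite (_ : _ \o _ = id); first exact: (mF k).2.
by apply/funext => p; exact: rV_consK.
Qed.

HB.instance Definition _ := Measure_isSigmaFinite.Build _ _ _ step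
  step_sigma_finite.

Lemma lebesgue_rV_step :
  exists nu : {sigma_finite_measure set 'rV[R]_n.+1 -> \bar R}, step = nu.
Proof. by exists step. Qed.

End step.

Lemma lebesgue_rV_ex n :
  exists mu : {sigma_finite_measure set 'rV[R]_n -> \bar R},
    @lebesgue_rV n = mu.
Proof.
elim: n => [|n [mu IH]] /=; first by exists (@dirac _ 'rV[R]_0 0 R).
by rewrite IH; exact: lebesgue_rV_step.
Qed.

Section instance.
Variable n : nat.

Let leb0 : @lebesgue_rV n set0 = 0%E.
Proof. by have [mu ->] := lebesgue_rV_ex n. Qed.

Let leb_ge0 A : (0 <= @lebesgue_rV n A)%E.
Proof. by have [mu ->] := lebesgue_rV_ex n. Qed.

Let leb_sigma_additive : semi_sigma_additive (@lebesgue_rV n).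
Proof.
have [mu ->] := lebesgue_rV_ex n; exact: measure_semi_sigma_additive.
Qed.

HB.instance Definition _ := isMeasure.Build _ _ _ (@lebesgue_rV n)
  leb0 leb_ge0 leb_sigma_additive.

Let leb_sigma_finite : sigma_finite setT (@lebesgue_rV n).
Proof. have [mu ->] := lebesgue_rV_ex n; exact: sigma_finiteT. Qed.

HB.instance Definition _ := Measure_isSigmaFinite.Build _ _ _ (@lebesgue_rV n)
  leb_sigma_finite.

End instance.

End lebesgue_rV.
Arguments lebesgue_rV {R} n.

Section euclidean.
Context {R : realType} {n : nat}.
Implicit Types x y : 'rV[R]_n.

Definition dotrv x y : R := \sum_i x ord0 i * y ord0 i.

(* The library norm `|x| on 'rV[R]_n is the sup norm. *)
Definition norm2 x : R := Num.sqrt (dotrv x x).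

Definition unit_ball2 : set 'rV[R]_n := [set x | norm2 x <= 1].

Definition unit_sphere2 : set 'rV[R]_n := [set x | norm2 x = 1].

Definition radial_proj x : 'rV[R]_n := (norm2 x)^-1 *: x.

Lemma measurable_norm2 : measurable_fun setT norm2.
Proof.
apply: measurableT_comp.
  by apply: continuous_measurable_fun; exact: sqrt_continuous.
apply: measurable_sum => i.
by apply: measurable_funM; exact: measurable_coord.
Qed.

Lemma measurable_unit_ball2 : measurable unit_ball2.
Proof.
have -> : unit_ball2 = norm2 @^-1` `]-oo, 1].
  by apply/seteqP; split => x /=; rewrite in_itv.
by rewrite -[X in measurable X]setTI; exact: measurable_norm2.
Qed.

Lemma measurable_radial_proj : measurable_fun setT radial_proj.
Proof.
apply: measurable_fun_rVP => i.
rewrite (_ : (fun _ => _) = fun x => norm2 x `^ (-1) * x ord0 i); last first.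
  by apply/funext => x; rewrite mxE powR_inv1// sqrtr_ge0.
apply: measurable_funM; last exact: measurable_coord.
exact: (measurableT_comp (measurable_powR (-1)) measurable_norm2).
Qed.

End euclidean.

(* Surface measure on S^(n-1), normalised by the polar coordinates formula: the
   measure of A `<=` S^(n-1) is n times the Lebesgue measure of the cone
   {r w | 0 < r <= 1, w in A}. It is a measure on R^n carried by the sphere
   (for n = 1, the counting measure on {-1, 1}). *)
Section surface_measure.
Context {R : realType} (n : nat).

Definition surface_measure (A : set 'rV[R]_n) : \bar R :=
  (n%:R%:E * lebesgue_rV n (unit_ball2 `&` radial_proj @^-1` A))%E.

Let cone : {measure set 'rV[R]_n -> \bar R} :=
  measure_function_pushforward__canonical__measure_function_Measure
    (mrestr (lebesgue_rV n) (@measurable_unit_ball2 R n))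
    (@measurable_radial_proj R n).

Let surfE : surface_measure = mscale (n%:R)%:nng cone.
Proof.
by apply/funext => A; rewrite /surface_measure /mscale/= /pushforward /mrestr setIC.
Qed.

Let surf0 : surface_measure set0 = 0%E. Proof. by rewrite surfE. Qed.

Let surf_ge0 A : (0 <= surface_measure A)%E. Proof. by rewrite surfE. Qed.

Let surf_sigma_additive : semi_sigma_additive surface_measure.
Proof. rewrite surfE; exact: measure_semi_sigma_additive. Qed.

HB.instance Definition _ := isMeasure.Build _ _ _ surface_measure
  surf0 surf_ge0 surf_sigma_additive.

End surface_measure.
Arguments surface_measure {R} n.

Section smooth.
Context {R : realType} {n : nat}.
Implicit Types (U : set 'rV[R]_n) (f : 'rV[R]_n -> R).

Definition partial (i : 'I_n) f : 'rV[R]_n -> R := 'D_(delta_mx ord0 i) f.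

(* C^infty on the open set U: all iterated partial derivatives exist and are
   continuous on U. *)
Definition smooth_on U f : Prop := forall (s : seq 'I_n) x, U x ->
  {for x, continuous (foldr partial f s)} /\
  forall i, derivable (foldr partial f s) x (delta_mx ord0 i).

Definition homogeneous (m : R) f : Prop :=
  f 0 = 0 /\
  forall (t : R) x, 0 < t -> x != 0 -> f (t *: x) = t `^ m * f x.

Definition smooth_cutoff (psi : 'rV[R]_n -> R[i]) : Prop :=
  [/\ smooth_on setT (fun x => complex.Re (psi x)),
      smooth_on setT (fun x => complex.Im (psi x)) &
      compact (closure [set x | psi x != 0])].

End smooth.

Definition Cintegral {d : measure_display} {T : measurableType d} {R : realType}
    (mu : {measure set T -> \bar R}) (D : set T) (f : T -> R[i]) : R[i] :=
  ((\int[mu]_(x in D) complex.Re (f x))%R +i*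
   (\int[mu]_(x in D) complex.Im (f x))%R)%C.

Definition expi {R : realType} (t : R) : R[i] := (cos t +i* sin t)%C.

Section oscillatory.
Context {R : realType} {n l : nat}.
Variable phi : 'I_l -> 'rV[R]_n -> R.

Definition Phi (x : 'rV[R]_n) : 'rV[R]_l := \row_j phi j x.

Definition Phi_lambda (lambda : 'rV[R]_l) (x : 'rV[R]_n) : R := dotrv (Phi x) lambda.

Definition oscF (psi : 'rV[R]_n -> R[i]) (xi : 'rV[R]_n) (lambda : 'rV[R]_l) :
    R[i] :=
  Cintegral (lebesgue_rV n) setT (fun x =>
    expi (dotrv x xi + \sum_j lambda ord0 j * phi j x) * psi x).

End oscillatory.

(* Main.v *)
Require Import Defs.
From mathcomp Require Import all_boot all_order all_algebra.
From mathcomp Require Import complex.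
From mathcomp Require Import all_classical all_reals all_analysis.
From mathcomp Require Import measurable_realfun.
From mathcomp Require Import ring lra.

(* Averaging over dilations replaces polar coordinates: since
   int_{|y|}^oo n s^(-n-1) ds = |y|^(-n), Tonelli and the scaling of Lebesgue
   measure give
     int f(y) dy = int_{|x| <= 1} n |x|^n int_0^oo s^(n-1) f(s x) ds dx,
   and the outer integral is the one that defines the surface measure.
   It remains to bound, uniformly in a, the one-dimensional integral
     int_0^oo cos(a s + b s^m + c) s^(n-1) g(s) ds
   by a multiple of |b|^(-n/m), where g(s) = psi(s x) has total variation bounded
   independently of x. Put delta = |b|^(-1/m), so that ]0, delta] contributes
   O(delta^n). On [delta, oo[ write the phase derivative as q(s) s^(n-1), that is
     q(s) = a s^(1-n) + b m s^(m-n)     (b > 0).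
   If a <= 0, then m >= 2n makes q increase at rate at least delta^(-2n) s^(n-1),
   and a second derivative test gives O(delta^n); if a > 0 there is no stationary
   point and q >= delta^(-n), so integrating by parts gives the same bound. *)

Set Implicit Arguments.
Unset Strict Implicit.
Unset Printing Implicit Defensive.
Import Order.TTheory GRing.Theory Num.Theory.
Import numFieldNormedType.Exports.

Local Open Scope classical_set_scope.
Local Open Scope ring_scope.

(** * One-dimensional oscillatory integrals *)

Section mean_value.
Context {R : realType}.
Implicit Types (u v x : R).

Lemma is_derive_within_continuous (f f' : R -> R) u v :
  (forall x, x \in `[u, v] -> is_derive x 1 f (f' x)) ->
  {within `[u, v], continuous f}.
Proof.
move=> df; apply: continuous_in_subspaceT => x /set_mem/= /df[+ _].
by move=> /derivable1_diffP/differentiable_continuous.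
Qed.

(** Both [g + f] and [g - f] have nonnegative derivative, hence are nondecreasing. This stands in
    for integrating [|f'|], so the oscillation estimates can be phrased with primitives only. *)
Lemma ler_norm_increment (f f' g g' : R -> R) u v : u <= v ->
  (forall x, x \in `[u, v] -> is_derive x 1 f (f' x)) ->
  (forall x, x \in `[u, v] -> is_derive x 1 g (g' x)) ->
  (forall x, x \in `[u, v] -> `|f' x| <= g' x) ->
  `|f v - f u| <= g v - g u.
Proof.
move=> uv df dg fg.
have monoD (h h' : R -> R) : (forall x, x \in `[u, v] -> is_derive x 1 h (h' x)) ->
    (forall x, x \in `[u, v] -> 0 <= h' x) -> h u <= h v.
  move=> dh h0.
  have dh' x : x \in `]u, v[ -> is_derive x 1 h (h' x).
    by move=> xuv; exact: dh (subset_itv_oo_cc xuv).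
  have ch := is_derive_within_continuous dh.
  have [c cuv hc] := @MVT_segment R h h' u v uv dh' ch.
  by rewrite -subr_ge0 hc mulr_ge0 ?subr_ge0// h0.
have h1 : g u + f u <= g v + f v.
  apply: (monoD (g \+ f) (g' \+ f')) => x xuv.
    by have := df x xuv; have := dg x xuv => ? ?; exact: is_deriveD.
  by have := fg x xuv; rewrite ler_norml => /andP[? ?]; rewrite /=; lra.
have h2 : g u - f u <= g v - f v.
  apply: (monoD (g \- f) (g' \- f')) => x xuv.
    by have := df x xuv; have := dg x xuv => ? ?; exact: is_deriveB.
  by have := fg x xuv; rewrite ler_norml => /andP[? ?]; rewrite /=; lra.
by rewrite ler_norml; apply/andP; split; lra.
Qed.

End mean_value.

(** * Van der Corput estimates, stated for primitives *)

Section van_der_corput.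
Context {R : realType}.
Implicit Types (u v x eta : R) (F theta q w : R -> R).

(* The second derivative test without locating the stationary point: integrate
   by parts against the smoothed reciprocal q / (q^2 + eta^2); all error terms
   are dominated by the derivative of atan (q / eta). *)
Lemma van_der_corput_increasing F theta q q' w eta u v : u <= v -> 0 < eta ->
  (forall x, x \in `[u, v] -> is_derive x 1 F (cos (theta x) * w x)) ->
  (forall x, x \in `[u, v] -> is_derive x 1 theta (q x * w x)) ->
  (forall x, x \in `[u, v] -> is_derive x 1 q (q' x)) ->
  (forall x, x \in `[u, v] -> 0 <= w x /\ eta ^+ 2 * w x <= q' x) ->
  `|F v - F u| <= (2 * pi + 1) / eta.
Proof.
move=> uv eta0 dF dtheta dq wq.
pose D x := q x ^+ 2 + eta ^+ 2.
have D0 x : 0 < D x by rewrite /D ltr_wpDl ?sqr_ge0 ?exprn_gt0.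
pose r x := q x * (D x)^-1.
pose H x := F x - sin (theta x) * r x.
pose H' x := cos (theta x) * w x * (eta ^+ 2 / D x)
  - sin (theta x) * (q' x * (eta ^+ 2 - q x ^+ 2) / D x ^+ 2).
pose K x := 2 / eta * atan (eta^-1 * q x).
pose K' x := 2 * q' x / D x.
have dH x : x \in `[u, v] -> is_derive x 1 H (H' x).
  move=> xuv; have ? := dF x xuv; have ? := dtheta x xuv; have ? := dq x xuv.
  have dD : is_derive x 1 D (2 * q x * q' x).
    rewrite /D; apply: is_derive_eq; rewrite addr0 /GRing.scale/=; ring.
  have dr : is_derive x 1 r (q x * (- (D x) ^- 2 * (2 * q x * q' x)) + (D x)^-1 * q' x).
    by have ? := is_deriveV (lt0r_neq0 (D0 x)) dD; exact: is_deriveM.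
  have ds : is_derive x 1 (sin \o theta) (cos (theta x) * (q x * w x)).
    exact: is_derive1_comp.
  have dsr : is_derive x 1 (fun x => sin (theta x) * r x) _ := is_deriveM ds dr.
  apply: (is_derive_eq (is_deriveB (dF x xuv) dsr)).
  have Dx0 := lt0r_neq0 (D0 x).
  rewrite /H' /GRing.scale/= /r.
  have -> : eta ^+ 2 = D x - q x ^+ 2 by rewrite /D; ring.
  by field.
have dK x : x \in `[u, v] -> is_derive x 1 K (K' x).
  move=> xuv; have ? := dq x xuv.
  have dqe : is_derive x 1 (fun x => eta^-1 * q x) (eta^-1 * q' x).
    exact: is_deriveZ.
  have da : is_derive x 1 (atan \o (fun x => eta^-1 * q x))
      ((1 + (eta^-1 * q x) ^+ 2)^-1 * (eta^-1 * q' x)).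
    exact: is_derive1_comp.
  apply: (is_derive_eq (is_deriveZ (2 / eta) da)).
  rewrite /K' /GRing.scale/=.
  have Dx0 := lt0r_neq0 (D0 x); have e0 := lt0r_neq0 eta0.
  have -> : 1 + (eta^-1 * q x) ^+ 2 = D x / eta ^+ 2 by rewrite /D; field.
  by field; rewrite Dx0 e0.
have HK x : x \in `[u, v] -> `|H' x| <= K' x.
  move=> /wq[w0 wq'].
  have q'0 : 0 <= q' x by apply: le_trans wq'; rewrite mulr_ge0// sqr_ge0.
  have iD : 0 < (D x)^-1 by rewrite invr_gt0.
  apply: le_trans (ler_normB _ _) _.
  (* One half for each term of [H']: the first by [eta ^+ 2 * w x <= q' x], the second because
     |eta^2 - q^2| is at most [D x]. *)
  have -> : K' x = q' x / D x + q' x / D x by rewrite /K'; ring.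
  apply: lerD.
    have -> : cos (theta x) * w x * (eta ^+ 2 / D x) =
      cos (theta x) * (eta ^+ 2 * w x / D x) by ring.
    have ew0 : 0 <= eta ^+ 2 * w x by rewrite mulr_ge0 ?sqr_ge0.
    rewrite -[leRHS]mul1r normrM ler_pM ?cos_max//.
    by rewrite ger0_norm ?(mulr_ge0 ew0 (ltW iD))// ler_pM2r.
  rewrite -[leRHS]mul1r normrM ler_pM ?sin_max//.
  have Dx0 := lt0r_neq0 (D0 x).
  have -> : q' x * (eta ^+ 2 - q x ^+ 2) / D x ^+ 2 =
    q' x / D x * ((eta ^+ 2 - q x ^+ 2) / D x) by field.
  rewrite normrM ger0_norm; last by rewrite mulr_ge0// ltW.
  rewrite ler_piMr//; first by rewrite mulr_ge0// ltW.
  rewrite normrM (gtr0_norm iD) ler_pdivrMr// mul1r ler_norml /D.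
  have := sqr_ge0 (q x); have := sqr_ge0 eta; lra.
have HKuv := ler_norm_increment uv dH dK HK.
have Kb : K v - K u <= 2 / eta * pi.
  rewrite /K -mulrBr ler_pM2l ?divr_gt0//.
  have := atan_gtNpi2 (eta^-1 * q u); have := atan_ltpi2 (eta^-1 * q v); lra.
(* Arithmetic-geometric mean: 2 eta |q| <= q^2 + eta^2. The two boundary terms together cost 1/eta,
   the remaining part of the constant. *)
have rb x : `|sin (theta x) * r x| <= (2 * eta)^-1.
  rewrite normrM -[leRHS]mul1r ler_pM ?sin_max//.
  rewrite /r normrM [X in _ * X]gtr0_norm ?invr_gt0// ler_pdivrMr// ler_pdivlMl ?mulr_gt0//.
  by rewrite /D -real_normK ?num_real//; have := sqr_ge0 (`|q x| - eta); lra.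
have FH : F v - F u = (H v - H u) + sin (theta v) * r v - sin (theta u) * r u.
  by rewrite /H; ring.
rewrite FH; apply: le_trans (ler_normB _ _) _.
apply: le_trans (lerD (le_trans (ler_normD _ _) (lerD (le_trans HKuv Kb) (rb v))) (rb u)) _.
by rewrite le_eqVlt; apply/orP; left; apply/eqP; field; exact: lt0r_neq0.
Qed.

(** Integration by parts against 1/q, which is at most 1/eta. The error term has size |q'|/q^2;
    since [q] need not be monotone, its integral is controlled by a primitive [Z] of a majorant, to
    be supplied by the caller. *)
Lemma van_der_corput_nonstationary F theta q q' w Z Z' eta u v :
  u <= v -> 0 < eta ->
  (forall x, x \in `[u, v] -> is_derive x 1 F (cos (theta x) * w x)) ->
  (forall x, x \in `[u, v] -> is_derive x 1 theta (q x * w x)) ->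
  (forall x, x \in `[u, v] -> is_derive x 1 q (q' x)) ->
  (forall x, x \in `[u, v] -> is_derive x 1 Z (Z' x)) ->
  (forall x, x \in `[u, v] -> eta <= q x /\ `|q' x| / q x ^+ 2 <= Z' x) ->
  `|F v - F u| <= 2 / eta + (Z v - Z u).
Proof.
move=> uv eta0 dF dtheta dq dZ qZ.
have q0 x : x \in `[u, v] -> 0 < q x by move=> /qZ[+ _]; exact: lt_le_trans.
pose H x := F x - sin (theta x) * (q x)^-1.
pose H' x := sin (theta x) * (q' x / q x ^+ 2).
have dH x : x \in `[u, v] -> is_derive x 1 H (H' x).
  move=> xuv; have ? := dF x xuv; have ? := dtheta x xuv; have ? := dq x xuv.
  have qx0 : q x != 0 by rewrite lt0r_neq0// q0.
  have di := is_deriveV qx0 (dq x xuv).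
  have ds : is_derive x 1 (sin \o theta) (cos (theta x) * (q x * w x)).
    exact: is_derive1_comp.
  have dsr : is_derive x 1 (fun x => sin (theta x) * (q x)^-1) _ := is_deriveM ds di.
  apply: (is_derive_eq (is_deriveB (dF x xuv) dsr)).
  by rewrite /H' /GRing.scale/=; field.
have HZ x : x \in `[u, v] -> `|H' x| <= Z' x.
  move=> xuv; have [_] := qZ x xuv; apply: le_trans.
  have qx0 := q0 x xuv.
  rewrite /H' normrM [in X in _ * X]normrM normfV normrX (gtr0_norm qx0).
  by rewrite ler_piMl ?sin_max// mulr_ge0// invr_ge0 sqr_ge0.
have HZuv := ler_norm_increment uv dH dZ HZ.
have rb x : x \in `[u, v] -> `|sin (theta x) * (q x)^-1| <= eta^-1.
  move=> xuv; rewrite normrM -[leRHS]mul1r ler_pM ?sin_max//.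
  rewrite normfV gtr0_norm ?q0// lef_pV2 ?posrE ?q0//.
  by have [] := qZ x xuv.
have FH : F v - F u =
    (H v - H u) + sin (theta v) * (q v)^-1 - sin (theta u) * (q u)^-1.
  by rewrite /H; ring.
have uuv : u \in `[u, v] by rewrite in_itv/= lexx.
have vuv : v \in `[u, v] by rewrite in_itv/= lexx uv.
rewrite FH; apply: le_trans (ler_normB _ _) _.
apply: le_trans (lerD (le_trans (ler_normD _ _) (lerD HZuv (rb v vuv))) (rb u uuv)) _.
by rewrite (_ : 2 / eta = eta^-1 + eta^-1); [lra|ring].
Qed.

End van_der_corput.

(** * Uniform bound for the phase a s + b s^m + c, with b = delta^(-m) *)

Section homogeneous_phase.
Context {R : realType}.
Implicit Types (a c s m N delta T : R) (F : R -> R).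

Lemma gt0_powRD s (r t : R) : 0 < s -> s `^ (r + t) = s `^ r * s `^ t.
Proof. by move=> s0; rewrite powRD// (gt_eqF s0) implybT. Qed.

Lemma homogeneous_phase_bound a c m N delta T F :
  1 <= N -> 2 * N <= m -> 0 < delta -> delta <= T ->
  (forall s, s \in `[delta, T] ->
    is_derive s 1 F (cos (a * s + delta `^ (- m) * s `^ m + c) * s `^ (N - 1))) ->
  `|F T - F delta| <= (2 * pi + 1) * delta `^ N.
Proof.
move=> N1 Nm delta0 deltaT dF.
pose b := delta `^ (- m).
have b0 : 0 < b by rewrite powR_gt0.
pose theta s := a * s + b * s `^ m + c.
pose q s := a * s `^ (1 - N) + b * m * s `^ (m - N).
pose q' s := a * ((1 - N) * s `^ (1 - N - 1)) + b * m * ((m - N) * s `^ (m - N - 1)).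
pose w s := s `^ (N - 1).
pose eta := delta `^ (- N).
have eta0 : 0 < eta by rewrite powR_gt0.
have etaV : eta^-1 = delta `^ N by rewrite /eta powRN invrK.
have s_gt0 s : s \in `[delta, T] -> 0 < s.
  by rewrite in_itv/= => /andP[+ _]; exact: lt_le_trans.
have dtheta s : s \in `[delta, T] -> is_derive s 1 theta (q s * w s).
  move=> /s_gt0 s0; have ? := is_derive1_powR m s0.
  apply: is_derive_eq; rewrite /GRing.scale/= /q /w mulrDl -!mulrA -!gt0_powRD//.
  by rewrite addrA subrK subrr powRr0 addrA subrK !addr0.
have dq s : s \in `[delta, T] -> is_derive s 1 q (q' s).
  move=> /s_gt0 s0; have ? := is_derive1_powR (1 - N) s0.
  have ? := is_derive1_powR (m - N) s0.
  by apply: is_derive_eq.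
have w0 s : 0 <= w s by exact: powR_ge0.
(* For a <= 0 the first term of [q'] is nonnegative because 1 - N <= 0, so the second term alone has
   to supply the growth. *)
have [a0|a0] := leP a 0.
  rewrite -etaV; apply: (van_der_corput_increasing deltaT eta0 dF dtheta dq).
  move=> s sdT; split; [exact: w0|]; have s0 := s_gt0 s sdT.
  have : 0 <= a * ((1 - N) * s `^ (1 - N - 1)).
    by rewrite mulrA mulr_ge0 ?powR_ge0// mulr_le0//; lra.
  suff : eta ^+ 2 * w s <= b * m * ((m - N) * s `^ (m - N - 1)).
    by rewrite /q' => h1 h2; apply: le_trans h1 _; rewrite lerDr.
  (* The exponent is nonnegative exactly when m >= 2N; this turns eta^2 = b delta^(m-2N) into a
     lower bound for the growth at every s >= delta. *)
  have ds : delta `^ (m - 2 * N) <= s `^ (m - 2 * N).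
    move: sdT; rewrite in_itv/= => /andP[ds _].
    by apply: ge0_ler_powR; rewrite ?nnegrE; lra.
  have -> : eta ^+ 2 = b * delta `^ (m - 2 * N).
    rewrite /eta /b expr2 -!gt0_powRD//; congr (_ `^ _); ring.
  have -> : s `^ (m - N - 1) = s `^ (m - 2 * N) * w s.
    by rewrite /w -gt0_powRD//; congr (_ `^ _); ring.
  have dw : b * (delta `^ (m - 2 * N) * w s) <= b * (s `^ (m - 2 * N) * w s).
    by rewrite ler_pM2l// ler_wpM2r.
  have mm : 1 <= m * (m - N) by nra.
  rewrite -mulrA (le_trans dw)//.
  have -> : b * m * ((m - N) * (s `^ (m - 2 * N) * w s)) =
     m * (m - N) * (b * (s `^ (m - 2 * N) * w s)) by ring.
  by rewrite ler_peMl// !mulr_ge0 ?powR_ge0// ltW.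
(* With q = s p, the bounds |q'| <= (m-N) p and p >= b s^(m-N-1) give |q'|/q^2 <= (m-N) / (b
   s^(m-N+1)); [Z] is the primitive of this majorant that tends to 0 at infinity when m > N. *)
pose Z s : R := - delta `^ m * s `^ (- (m - N)).
pose Z' s : R := - delta `^ m * (- (m - N) * s `^ (- (m - N) - 1)).
have dZ s : s \in `[delta, T] -> is_derive s 1 Z (Z' s).
  move=> /s_gt0 s0; have ? := is_derive1_powR (- (m - N)) s0.
  exact: is_deriveZ.
have := van_der_corput_nonstationary deltaT eta0 dF dtheta dq dZ.
have qZ s : s \in `[delta, T] -> eta <= q s /\ `|q' s| / q s ^+ 2 <= Z' s.
  move=> sdT; have s0 := s_gt0 s sdT.
  pose p := a * s `^ (- N) + b * m * s `^ (m - N - 1).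
  have sE r : s `^ r = s * s `^ (r - 1).
    by rewrite -[X in X * _](@powRr1 _ s) ?ltW// -gt0_powRD// addrC subrK.
  have qE : q s = s * p.
    rewrite /q (sE (1 - N)) (sE (m - N)) /p.
    by rewrite (_ : 1 - N - 1 = - N); ring.
  have bp : b * s `^ (m - N - 1) <= p.
    have : 0 <= a * s `^ (- N) by rewrite mulr_ge0 ?powR_ge0 ?ltW.
    have : b * s `^ (m - N - 1) <= b * m * s `^ (m - N - 1).
      by rewrite -mulrA ler_pM2l// ler_peMl ?powR_ge0//; lra.
    by rewrite /p; lra.
  have bs0 : 0 < b * s `^ (m - N - 1) by rewrite mulr_gt0// powR_gt0.
  have p0 : 0 < p by exact: lt_le_trans bp.
  split.
    rewrite qE; apply: le_trans (ler_wpM2l (ltW s0) bp).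
    rewrite mulrCA -sE.
    have -> : eta = b * delta `^ (m - N).
      by rewrite /eta /b -gt0_powRD//; congr (_ `^ _); ring.
    rewrite ler_pM2l//; move: sdT; rewrite in_itv/= => /andP[ds _].
    by apply: ge0_ler_powR; rewrite ?nnegrE; lra.
  (* Since m >= 2N, the coefficient |1 - N| of the first term is at most m - N, and for a > 0 both
     terms of [p] are nonnegative. *)
  have q'p : `|q' s| <= (m - N) * p.
    have h1 : 0 <= a * s `^ (- N) by rewrite mulr_ge0 ?powR_ge0// ltW.
    have h2 : 0 <= b * m * s `^ (m - N - 1).
      by rewrite !mulr_ge0 ?powR_ge0// ?ltW//; lra.
    have -> : q' s = (1 - N) * (a * s `^ (- N)) + (m - N) * (b * m * s `^ (m - N - 1)).
      by rewrite /q' (_ : 1 - N - 1 = - N); ring.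
    rewrite /p; move: h1 h2; set x := a * _; set y := _ * s `^ _ => h1 h2.
    by rewrite ler_norml; apply/andP; split; nra.
  rewrite ler_pdivrMr ?exprn_gt0 ?qE ?mulr_gt0//; apply: le_trans q'p _.
  have -> : Z' s = (m - N) * (b * (s * s) * s `^ (m - N - 1))^-1.
    rewrite /Z' /b powRN !invfM invrK.
    rewrite (_ : - (m - N) - 1 = - (2 + (m - N - 1))); last ring.
    rewrite powRN (gt0_powRD 2 (m - N - 1) s0) invfM.
    have -> : s `^ 2 = s * s by rewrite -expr2 powR_mulrn ?ltW.
    by rewrite invfM; ring.
  rewrite -[leRHS]mulrA ler_pM2l; last by lra.
  rewrite [leRHS]mulrC ler_pdivlMr; last by rewrite !mulr_gt0// powR_gt0.
  have -> : (s * p) ^+ 2 = p * (s * s * p) by ring.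
  rewrite ler_pM2l//.
  have -> : b * (s * s) * s `^ (m - N - 1) = s * s * (b * s `^ (m - N - 1)) by ring.
  by rewrite ler_pM2l// mulr_gt0.
move=> /(_ qZ) /le_trans; apply.
have ZT : Z T <= 0.
  by rewrite /Z mulNr oppr_le0 mulr_ge0 ?powR_ge0.
have Zd : - Z delta = delta `^ N.
  rewrite /Z mulNr opprK -gt0_powRD//; congr (_ `^ _); ring.
(* This case yields 2 delta^N from the boundary and at most delta^N from [Z]; pi >= 2 absorbs the
   factor 3 into the constant of the other case. *)
have := pi_ge2 R; have : 0 <= delta `^ N := powR_ge0 _ _.
rewrite etaV; set D := delta `^ N in Zd *; move=> D0 pi2.
have : 2 * D <= pi * D by rewrite ler_wpM2r.
lra.
Qed.

End homogeneous_phase.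

(** * The radial integral with an amplitude *)

Section radial_integral.
Context {R : realType}.
Notation mu := (@lebesgue_measure R).
Implicit Types (a b c s m N delta T L M : R) (h g : R -> R).

Lemma gt0_primitive h delta : 0 < delta ->
  (forall s, 0 < s -> {for s, continuous h}) ->
  exists2 J : R -> R, (forall s, delta <= s -> is_derive s 1 J (h s)) &
    forall T, delta < T ->
      (\int[mu]_(s in `[delta, T]) (h s)%:E = (J T - J delta)%:E)%E.
Proof.
(* Starting at [delta / 2] stays away from a possible singularity of [h] at 0 and makes [J]
   differentiable from both sides at [delta]. *)
move=> d0 ch; pose J s := (\int[mu]_(t in `[delta / 2, s]) h t)%R.
have d20 : 0 < delta / 2 by rewrite divr_gt0.
have d2d : delta / 2 < delta by lra.
have cw (x y : R) : 0 < x -> {within `[x, y], continuous h}.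
  move=> x0; apply: continuous_in_subspaceT => s /set_mem/=; rewrite in_itv/=.
  by move=> /andP[xs _]; apply: ch; exact: lt_le_trans xs.
have dJ s : delta <= s -> is_derive s 1 J (h s).
  move=> ds; have s0 : 0 < s by exact: lt_le_trans ds.
  have ss : s < s + 1 by rewrite ltrDl.
  have ih : mu.-integrable `[delta / 2, s + 1] (EFin \o h).
    by apply: continuous_compact_integrable; [exact: segment_compact|exact: cw].
  have [dJs J's] := continuous_FTC1_closed ss ih (lt_le_trans d2d ds) (ch s s0).
  by split; [exact: dJs|rewrite -derive1E].
exists J => // T dT; rewrite EFinB; apply: continuous_FTC2 => //.
- exact: cw.
- split.
  + by move=> x; rewrite in_itv/= => /andP[/ltW/dJ[]].
  + have [+ _] := dJ delta (lexx _) => /derivable1_diffP/differentiable_continuous.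
    exact: cvg_at_right_filter.
  + have [+ _] := dJ T (ltW dT) => /derivable1_diffP/differentiable_continuous.
    exact: cvg_at_left_filter.
- move=> x; rewrite in_itv/= => /andP[/ltW/dJ[_ <-] _].
  by rewrite derive1E.
Qed.

Lemma homogeneous_phase_continuous a b c m N s : 0 < s ->
  {for s, continuous (fun s => cos (a * s + b * s `^ m + c) * s `^ (N - 1))}.
Proof.
move=> s0; have ? := is_derive1_powR m s0; have ? := is_derive1_powR (N - 1) s0.
have dth : is_derive s 1 (fun s => a * s + b * s `^ m + c) (a + b * (m * s `^ (m - 1))).
  by apply: is_derive_eq; rewrite /GRing.scale/= mulr1 addr0.
have dcos : is_derive s 1 (cos \o (fun s => a * s + b * s `^ m + c)) _ :=
  is_derive1_comp (is_derive_cos _) dth.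
have [+ _] : is_derive s 1
    (fun s => cos (a * s + b * s `^ m + c) * s `^ (N - 1)) _ :=
  is_deriveM dcos (is_derive1_powR (N - 1) s0).
by move=> /derivable1_diffP/differentiable_continuous.
Qed.

(** Integration by parts moves the derivative onto [g]. The boundary terms vanish, at [delta] by the
    choice of primitive and at [T] by [g T = 0], and what remains is [g'] times an oscillatory
    integral bounded uniformly over all upper limits. *)
Lemma amplitude_bound a c m N delta T L g (g' : R -> R) :
  1 <= N -> 2 * N <= m -> 0 < delta -> delta < T ->
  (forall s, 0 < s -> is_derive s 1 g (g' s)) ->
  (forall s, s \in `[delta, T] -> `|g' s| <= L) -> g T = 0 ->
  (`|\int[mu]_(s in `[delta, T])
    (cos (a * s + delta `^ (- m) * s `^ m + c) * s `^ (N - 1) * g s)%:E|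
   <= ((2 * pi + 1) * delta `^ N * (L * (T - delta)))%:E)%E.
Proof.
move=> N1 Nm d0 dT dg gL gT.
pose k s := cos (a * s + delta `^ (- m) * s `^ m + c) * s `^ (N - 1).
have ck s : 0 < s -> {for s, continuous k} by exact: homogeneous_phase_continuous.
have ckg s : 0 < s -> {for s, continuous (fun s => k s * g s)}.
  move=> s0; apply: continuousM; first exact: ck.
  by have [+ _] := dg s s0 => /derivable1_diffP/differentiable_continuous.
have [F dF _] := gt0_primitive d0 ck.
have [J dJ JE] := gt0_primitive d0 ckg.
rewrite JE// abse_EFin lee_fin.
set A := _ * delta `^ N.
(* Subtracting the product cancels the oscillating factor [k * g], leaving only the term with
   [g']. *)
pose H s := J s - (F s - F delta) * g s.
have dH s : s \in `[delta, T] -> is_derive s 1 H (- ((F s - F delta) * g' s)).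
  rewrite in_itv/= => /andP[ds _].
  have ? := dF s ds; have ? := dJ s ds; have ? := dg s (lt_le_trans d0 ds).
  have dFc : is_derive s 1 (fun s => F s - F delta) (k s).
    by apply: is_derive_eq; rewrite subr0.
  apply: (is_derive_eq (is_deriveB (dJ s ds) (is_deriveM dFc (dg s (lt_le_trans d0 ds))))).
  by rewrite /GRing.scale/=; ring.
pose B s := A * L * s.
have dB s : s \in `[delta, T] -> is_derive s 1 B (A * L).
  by move=> _; apply: is_derive_eq; rewrite /GRing.scale/= mulr1.
have HB s : s \in `[delta, T] -> `|- ((F s - F delta) * g' s)| <= A * L.
  move=> sdT; rewrite normrN normrM ler_pM ?gL//.
  move: sdT; rewrite in_itv/= => /andP[ds sT].
  apply: (@homogeneous_phase_bound R a c m N delta s F N1 Nm d0 ds) => t.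
  by rewrite in_itv/= => /andP[dt _]; exact: dF.
have := ler_norm_increment (ltW dT) dH dB HB.
rewrite /H gT subrr mul0r mulr0 !subr0 => /le_trans; apply.
by rewrite /B le_eqVlt; apply/orP; left; apply/eqP; ring.
Qed.

(** Split at delta = |b|^(-1/m). Up to [delta] the size of the integrand gives M delta^N; beyond it
    [amplitude_bound] applies, with [L * T] bounding the variation of [g] on the part of its support
    that matters. *)
Lemma radial_integral_bound a b c m N T L M g (g' : R -> R) :
  1 <= N -> 2 * N <= m -> b != 0 -> 0 < T ->
  (forall s, 0 < s -> is_derive s 1 g (g' s)) ->
  (forall s, 0 < s -> s <= T -> `|g' s| <= L) ->
  (forall s, 0 < s -> `|g s| <= M) ->
  (forall s, T <= s -> g s = 0) ->
  (`|\int[mu]_(s in `]0%R, +oo[)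
    (cos (a * s + b * s `^ m + c) * s `^ (N - 1) * g s)%:E|
   <= ((M + (2 * pi + 1) * (L * T)) * `|b| `^ (- (N / m)))%:E)%E.
Proof.
move=> N1 Nm b0 T0 dg gL gM gT.
(* The cosine is even, so [a], [b] and [c] may all change sign together. *)
wlog bp : a b c b0 / 0 < b.
  move=> H; have [bp|] := ltrP 0 b; first exact: H.
  rewrite le_eqVlt (negbTE b0)/= => bn.
  have := H (- a) (- b) (- c); rewrite oppr_eq0 normrN oppr_gt0 => /(_ b0 bn).
  under eq_integral => s _ do rewrite !mulNr -!opprD cosN.
  exact.
pose delta := b `^ (- m^-1).
have m0 : 0 < m by lra.
have d0 : 0 < delta by rewrite powR_gt0.
have bE : b = delta `^ (- m).
  by rewrite /delta -powRrM mulrNN mulVf ?lt0r_neq0// powRr1// ltW.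
have dN : `|b| `^ (- (N / m)) = delta `^ N.
  by rewrite gtr0_norm// /delta -powRrM mulNr mulrC.
pose h s := cos (a * s + b * s `^ m + c) * s `^ (N - 1) * g s.
have ch s : 0 < s -> {for s, continuous h}.
  move=> s0; apply: continuousM; first exact: homogeneous_phase_continuous.
  by have [+ _] := dg s s0 => /derivable1_diffP/differentiable_continuous.
have mh : measurable_fun (`]0, +oo[ : set R) h.
  apply: open_continuous_measurable_fun; first exact: interval_open.
  by move=> s /set_mem/=; rewrite in_itv/= andbT; exact: ch.
have M0 : 0 <= M by apply: le_trans (gM 1 _); rewrite ?normr_ge0.
have L0 : 0 <= L by apply: le_trans (gL T _ _); rewrite ?normr_ge0.
rewrite dN.
have hb s : 0 < s -> `|h s| <= M * s `^ (N - 1).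
  move=> s0; rewrite /h normrM mulrC ler_pM ?gM// normrM.
  by rewrite (ger0_norm (powR_ge0 _ _)) ler_piMl ?powR_ge0 ?cos_max.
have setE : `]0, +oo[%classic = `]0, delta] `|` `]delta, +oo[ :> set R.
  by rewrite -itv_bndbnd_setU// bnd_simp ltW.
have mhE (A : set R) : A `<=` `]0, +oo[ -> measurable_fun A (EFin \o h).
  by move=> A0; apply/measurable_EFinP; exact: measurable_funS mh.
have h1 : (`|\int[mu]_(s in `]0%R, delta]) (h s)%:E| <= (M * delta `^ N)%:E)%E.
  have A0 : `]0, delta]%classic `<=` (`]0, +oo[ : set R).
    by rewrite setE; exact: subsetUl.
  apply: le_trans (le_abse_integral _ _ _) _ => //; first exact: mhE.
  have hM : (\int[mu]_(s in `]0%R, delta]) `|(EFin \o h) s| <=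
      (M * delta `^ (N - 1))%:E * mu `]0%R, delta])%E.
    apply: integral_le_bound => //.
    - exact: mhE.
    - by rewrite lee_fin mulr_ge0 ?powR_ge0.
    - apply: aeW => s /=; rewrite in_itv/= => /andP[s0 sd].
      rewrite lee_fin (le_trans (hb s s0))// ler_wpM2l//.
      by apply: ge0_ler_powR; rewrite ?nnegrE; lra.
  apply: le_trans hM _; rewrite lebesgue_measure_itv/= lte_fin d0 sube0.
  rewrite -EFinM lee_fin -mulrA -[X in _ * (_ * X)](powRr1 (ltW d0)).
  by rewrite -gt0_powRD// subrK.
have h2 : (`|\int[mu]_(s in `]delta, +oo[) (h s)%:E| <=
    ((2 * pi + 1) * (L * T) * delta `^ N)%:E)%E.
  have tail t : T <= t -> (\int[mu]_(s in `]t, +oo[) (h s)%:E = 0)%E.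
    move=> Tt; apply: integral0_eq => s /=; rewrite in_itv/= andbT => ts.
    by rewrite /h gT ?mulr0// (le_trans Tt)// ltW.
  have pi0 := pi_ge0 R.
  have [Td|dT] := leP T delta.
    by rewrite tail// abse0 lee_fin !mulr_ge0 ?powR_ge0 ?(ltW T0)//; lra.
  have setE' : `]delta, +oo[%classic = `]delta, T] `|` `]T, +oo[ :> set R.
    by rewrite -itv_bndbnd_setU// bnd_simp ltW.
  have A0 : `]delta, +oo[%classic `<=` (`]0, +oo[ : set R).
    by rewrite setE; exact: subsetUr.
  rewrite setE' integral_setU//; last 2 first.
  - by apply: mhE; rewrite -setE'.
  - by apply/disj_setPS => s /= []; rewrite !in_itv/= => /andP[_ sd]; rewrite andbT ltNge sd.
  rewrite tail// adde0 integral_itv_obnd_cbnd; last first.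
    by apply: mhE; apply: subset_trans A0; rewrite setE'; exact: subsetUl.
  rewrite /h bE.
  have gL' s : s \in `[delta, T] -> `|g' s| <= L.
    rewrite in_itv/= => /andP[ds sT]; apply: gL => //; exact: lt_le_trans ds.
  apply: le_trans (amplitude_bound a c N1 Nm d0 dT dg gL' (gT T (lexx _))) _.
  rewrite lee_fin [leLHS]mulrAC ler_wpM2r ?powR_ge0//.
  by rewrite ler_wpM2l//; [lra|rewrite ler_wpM2l//; lra].
rewrite setE integral_setU//; last 2 first.
- by apply: mhE; rewrite -setE.
- by apply/disj_setPS => s /= []; rewrite !in_itv/= => /andP[_ sd]; rewrite andbT ltNge sd.
apply: le_trans (lee_abs_add _ _) _; rewrite mulrDl EFinD.
exact: leeD.
Qed.

End radial_integral.

(** * Directional derivatives from continuous partial derivatives *)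

Section continuous_partials.
Context {R : realType}.

Lemma MVT_unordered (f f' : R -> R) :
  (forall x : R, is_derive x 1 f (f' x)) ->
  forall u v : R, exists2 t, `|t - u| <= `|v - u| & f v - f u = f' t * (v - u).
Proof.
move=> df u v; have [uv|/ltW vu] := leP u v.
  have [c cuv fE] := @MVT_segment R f f' u v uv (fun x _ => df x)
    (is_derive_within_continuous (fun x _ => df x)).
  exists c => //; move: cuv; rewrite in_itv/= => /andP[uc cv].
  by rewrite !ger0_norm ?subr_ge0// lerB.
have [c cvu fE] := @MVT_segment R f f' v u vu (fun x _ => df x)
  (is_derive_within_continuous (fun x _ => df x)).
exists c; last by rewrite -opprB fE -mulrN opprB.
move: cvu; rewrite in_itv/= => /andP[vc cu].
by rewrite !ler0_norm ?subr_le0// !opprB lerB.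
Qed.

Context {n : nat}.
Implicit Types (f : 'rV[R]_n -> R) (p v x : 'rV[R]_n).

Lemma is_derive_line f p v (s d : R) :
  is_derive (p + s *: v) v f d -> is_derive s 1 (fun t => f (p + t *: v)) d.
Proof.
move=> [df dE].
have E : (fun h : R => h^-1 *: (((fun t => f (p + t *: v)) \o shift s) (h *: 1)
    - f (p + s *: v))) =
  (fun h : R => h^-1 *: ((f \o shift (p + s *: v)) (h *: v) - f (p + s *: v))).
  apply/funext => h /=; congr (_ *: (f _ - _)).
  by rewrite [h *: 1]mulr1 scalerDl addrCA.
by split; [rewrite /derivable E|rewrite /derive E].
Qed.

(** The increment along [h *: v] is telescoped over the coordinates. Each piece is a mean value
    along one axis, taken at a point that tends to [x], where continuity of the partial derivative
    applies. *)
Lemma is_derive_continuous_partials f :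
  (forall (i : 'I_n) x, derivable f x (delta_mx ord0 i)) ->
  (forall i, continuous (partial i f)) ->
  forall x v, is_derive x v f (\sum_i v ord0 i * partial i f x).
Proof.
move=> df cf x v.
have step (i : 'I_n) (c : R) (w : 'rV[R]_n) : h^-1 * (f (x + h *: (w + c *: delta_mx ord0 i)) -
    f (x + h *: w)) @[h --> (0 : R)^'] --> c * partial i f x.
  pose e : 'rV[R]_n := delta_mx ord0 i.
  (* [z h] is the mean value point on the axis-parallel segment; its distance to [x] is O(|h|). *)
  have /choice[z zP] (h : R) : exists z : 'rV[R]_n,
      `|z - x| <= `|h| * (`|w| + `|c| * `|e|) /\
      f (x + h *: (w + c *: e)) - f (x + h *: w) = h * c * partial i f z.
    have dl (t : R) : is_derive t 1 (fun t => f (x + h *: w + t *: e))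
        (partial i f (x + h *: w + t *: e)).
      by apply: is_derive_line; apply: derivableP; exact: df.
    have [t th fE] := MVT_unordered dl 0 (h * c).
    exists (x + h *: w + t *: e); split.
      rewrite !subr0 in th.
      rewrite -[x + _ + _]addrA [x + _]addrC addrK (le_trans (ler_normD _ _))//.
      rewrite !normrZ mulrDr lerD2l mulrA -normrM; exact: ler_wpM2r.
    move: fE; rewrite scale0r addr0 subr0 [RHS]mulrC => <-.
    by rewrite scalerDr scalerA addrA.
  have zx : z h @[h --> (0 : R)^'] --> x.
    apply/cvgrPdist_le => eps eps0.
    pose K := `|w| + `|c| * `|e| + 1.
    have K0 : 0 < K by rewrite ltr_wpDl// addr_ge0// mulr_ge0.
    near=> h; rewrite distrC; have [zh _] := zP h; apply: le_trans zh _.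
    have hK : `|h| <= eps / K.
      near: h; apply: dnbhs0_le; exact: divr_gt0.
    apply: le_trans (_ : eps / K * K <= _); last by rewrite divfK// gt_eqF.
    by rewrite ler_pM ?addr_ge0 ?mulr_ge0// lerDl.
  have : c * partial i f (z h) @[h --> (0 : R)^'] --> c * partial i f x.
    by apply: cvgM; [exact: cvg_cst|exact: continuous_cvg (cf i x) zx].
  apply: cvg_trans; apply: near_eq_cvg; near=> h.
  have h0 : h != 0 by near: h; exact: nbhs_dnbhs_neq.
  have [_ ->] := zP h; by rewrite !mulrA mulVf// mul1r.
(* Induction over a list of coordinates: consing an index adds one axis-parallel displacement to
   those already made. *)
have cvgs (s : seq 'I_n) :
  h^-1 * (f (x + h *: \sum_(i <- s) v ord0 i *: delta_mx ord0 i) - f x)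
    @[h --> (0 : R)^'] --> \sum_(i <- s) v ord0 i * partial i f x.
  elim: s => [|i s IH].
    rewrite !big_nil.
    under eq_fun do rewrite scaler0 addr0 subrr mulr0.
    exact: cvg_cst.
  rewrite !big_cons.
  set w := \sum_(i <- s) v ord0 i *: delta_mx ord0 i.
  have D := cvgD (step i (v ord0 i) w) IH.
  apply: cvg_trans (D (dnbhs_filter _)); apply: near_eq_cvg; near=> h => /=.
  by rewrite -mulrDr addrA subrK [_ + w]addrC.
have := cvgs (index_enum 'I_n).
under eq_fun do rewrite -row_sum_delta.
move=> vD.
have E : (fun h : R => h^-1 *: ((f \o shift x) (h *: v) - f x)) =
    (fun h => h^-1 * (f (x + h *: v) - f x)).
  by apply/funext => h /=; rewrite [h *: v + x]addrC.
split; first by rewrite /derivable E; apply/cvg_ex; eexists; exact: vD.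
by rewrite /derive E; exact: cvg_lim vD.
Unshelve. all: by end_near. Qed.

End continuous_partials.

(** * Lebesgue measure on row vectors and polar coordinates *)

Section borel_rV.
Context {R : realType} {n : nat}.
Implicit Types (U : set 'rV[R]_n) (f : 'rV[R]_n -> R).

Lemma measurable_ball_rV (x : 'rV[R]_n) (e : R) : measurable (ball x e).
Proof.
(* The condition [0 < e] matters for n = 0, where the intersection over coordinates is the whole
   space. *)
have -> : ball x e = [set _ | 0 < e] `&` \bigcap_(i in [set: 'I_n])
    [set y : 'rV[R]_n | ball (x ord0 i) e (y ord0 i)].
  apply/seteqP; split => [y [e0 xy]|y [e0 xy]]; split => //.
    by move=> i _; exact: xy.
  by move=> i j; rewrite (ord1 i); exact: xy.
apply: measurableI.
  by case: (ltP 0 e) => _; [rewrite set_true|rewrite set_false].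
apply: fin_bigcap_measurable => // i _.
rewrite -[X in measurable X]setTI.
by apply: (measurable_coord i measurableT); exact: measurable_ball.
Qed.

(** An open set is the countable union of the balls with rational centre and radius 1/(k+1) that it
    contains. This links the coordinate sigma-algebra to the topology. *)
Lemma open_measurable_rV U : open U -> measurable U.
Proof.
move=> oU.
pose c (p : 'rV[rat]_n * nat) : 'rV[R]_n := map_mx ratr p.1.
pose B p := if `[< ball (c p) p.2.+1%:R^-1 `<=` U >]
  then ball (c p) p.2.+1%:R^-1 else set0.
suff -> : U = \bigcup_p B p.
  apply: countable_bigcupT_measurable => // p.
  by rewrite /B; case: ifPn => // _; exact: measurable_ball_rV.
apply/seteqP; split => [x Ux|x [p _]]; last first.
  by rewrite /B; case: ifPn => // /asboolP; exact.
have /nbhs_ballP[e /= e0 xeU] : nbhs x U by rewrite nbhsE/=; exists U.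
have e20 : 0 < e / 2 by rewrite divr_gt0.
have [k ke] : exists k : nat, k.+1%:R^-1 < e / 2.
  by have [k _ /(_ k (leqnn k))] := near_infty_natSinv_lt (PosNum e20); exists k.
have k0 : 0 < k.+1%:R^-1 :> R by rewrite invr_gt0.
have /choice[q qP] (i : 'I_n) : exists q : rat,
    ball (ratr q : R) k.+1%:R^-1 (x ord0 i).
  have /rat_in_itvoo[q] : x ord0 i - k.+1%:R^-1 < x ord0 i + k.+1%:R^-1.
    by rewrite ltrBlDr -addrA ltrDl addr_gt0.
  rewrite in_itv/= => /andP[q1 q2]; exists q.
  by rewrite /ball/= ltr_distl q1.
pose p := (\row_i q i, k).
have px : ball (c p) k.+1%:R^-1 x.
  by split => // i j; rewrite (ord1 i) !mxE; exact: qP.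
exists p => //; rewrite /B asboolT// => y py; apply: xeU.
by apply: (@ball_splitr _ _ (c p)); apply: le_ball (ltW ke) _ _.
Qed.

Lemma open_continuous_measurable_rV U f : open U ->
  {in U, continuous f} -> measurable_fun U f.
Proof.
move=> oU cf.
apply: (measurability _ (RGenOpens.measurableE R)) => _ [_ [a [b ->] <-]].
apply: open_measurable_rV; rewrite openE => x [Ux fx].
apply: filterI; first exact: open_nbhs_nbhs.
apply: (cf x (mem_set Ux)); apply: open_nbhs_nbhs; split => //.
Qed.

Lemma open_rV_neq0 : open [set~ 0 : 'rV[R]_n].
Proof.
apply/closed_openC/accessible_closed_set1/hausdorff_accessible.
exact: norm_hausdorff.
Qed.

Lemma measurable_rV_set0 : measurable [set 0 : 'rV[R]_n].
Proof.
rewrite -[X in measurable X]setCK.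
by apply: measurableC; apply: open_measurable_rV; exact: open_rV_neq0.
Qed.

Lemma continuous_off0_measurable_rV f :
  (forall x : 'rV[R]_n, x != 0 -> {for x, continuous f}) ->
  measurable_fun setT f.
Proof.
move=> cf.
rewrite -(setvU [set 0 : 'rV[R]_n]).
apply/measurable_funU; [by apply: measurableC; exact: measurable_rV_set0|exact: measurable_rV_set0|].
split; last exact: measurable_fun_set1.
by apply: (open_continuous_measurable_rV open_rV_neq0) => x /set_mem/= /eqP; exact: cf.
Qed.

End borel_rV.

(** * Iterated integration, dilations and null sets for Lebesgue measure *)

Section lebesgue_rV_integral.
Context {R : realType}.
Local Open Scope ereal_scope.
Notation mu := (@lebesgue_measure R).

Lemma ge0_integral_lebesgue_rVS n (f : 'rV[R]_n.+1 -> \bar R) :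
  measurable_fun setT f -> (forall x, 0 <= f x) ->
  \int[lebesgue_rV n.+1]_x f x =
  \int[mu]_a \int[lebesgue_rV n]_x f (rV_cons (a, x)).
Proof.
move=> mf f0.
pose p : {measure set 'rV[R]_n.+1 -> \bar R} :=
  measure_function_pushforward__canonical__measure_function_Measure
    (mu \x lebesgue_rV n) (@measurable_rV_cons R n).
transitivity (\int[p]_x f x); first exact: eq_measure_integral.
rewrite /p/= (ge0_integral_pushforward (@measurable_rV_cons R n))//.
rewrite preimage_setT fubini_tonelli1//.
  by apply: measurableT_comp => //; exact: measurable_rV_cons.
by move=> x; exact: f0.
Qed.

Lemma measurable_integral_rV_cons n (f : 'rV[R]_n.+1 -> \bar R) :
  measurable_fun setT f -> (forall x, 0 <= f x) ->
  measurable_fun setT (fun a : R => \int[lebesgue_rV n]_x f (rV_cons (a, x))).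
Proof.
move=> mf f0.
apply: (@measurable_fun_fubini_tonelli_F _ _ (measurableTypeR R) 'rV[R]_n R
  (lebesgue_rV n) (fun p => f (rV_cons p))) => //.
by apply: measurableT_comp => //; exact: measurable_rV_cons.
Qed.

(** The image of Lebesgue measure under multiplication by [s], rescaled by [s], agrees with it on
    half-open intervals; uniqueness does the rest. *)
Lemma ge0_integral_lebesgue_scale (s : R) (f : R -> \bar R) : (0 < s)%R ->
  measurable_fun setT f -> (forall x, 0 <= f x) ->
  s%:E * \int[mu]_x f (s * x)%R = \int[mu]_x f x.
Proof.
move=> s0 mf f0.
have ms : measurable_fun setT (fun x : measurableTypeR R => s * x : measurableTypeR R)%R.
  exact: measurable_funM.
pose p : {measure set (measurableTypeR R) -> \bar R} :=
  measure_function_pushforward__canonical__measure_function_Measure mu ms.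
pose k : {nonneg R} := NngNum (ltW s0).
have -> : \int[mu]_x f x = \int[mscale k p]_x f x.
  apply: eq_measure_integral => A mA _; apply: lebesgue_measure_unique => //.
  move=> _ [[a b]] _ <-.
  have pE : p `]a, b]%classic = mu `](a / s)%R, (b / s)%R].
    congr (mu _); apply/seteqP; split => x /=; rewrite !in_itv/=.
      by rewrite ltr_pdivrMr// ler_pdivlMr// (mulrC s).
    by rewrite ltr_pdivrMr// ler_pdivlMr// (mulrC s).
  change (mu `]a, b] = s%:E * p `]a, b]%classic); rewrite pE.
  rewrite !lebesgue_measure_itv/= !lte_fin ltr_pM2r ?invr_gt0//.
  case: ifPn => _; last by rewrite mule0.
  by rewrite -EFinB -EFinM -mulrBl mulrC divfK ?gt_eqF// EFinB.
rewrite ge0_integral_mscale//=; congr (_ * _).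
by rewrite (ge0_integral_pushforward ms)// preimage_setT.
Qed.

Lemma measurable_scale_rV n (s : R) :
  measurable_fun setT (fun x : 'rV[R]_n => s *: x).
Proof.
apply: measurable_fun_rVP => i; under eq_fun do rewrite mxE.
by apply: measurable_funM => //; exact: measurable_coord.
Qed.

Lemma rV_consZ n (s a : R) (x : 'rV[R]_n) :
  (s *: rV_cons (a, x) = rV_cons (s * a, s *: x))%R.
Proof.
apply/rowP => i; rewrite mxE; case: (unliftP ord0 i) => [j|] ->.
  by rewrite !rV_consS/= mxE.
by rewrite !rV_cons0.
Qed.

(** Induction on the dimension by Tonelli: one factor [s] comes from the first coordinate, the
    others from the induction hypothesis. *)
Lemma ge0_integral_lebesgue_rV_scale n (s : R) (f : 'rV[R]_n -> \bar R) :
  (0 < s)%R -> measurable_fun setT f -> (forall x, 0 <= f x) ->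
  (s ^+ n)%:E * \int[lebesgue_rV n]_x f (s *: x) = \int[lebesgue_rV n]_x f x.
Proof.
move=> s0; elim: n f => [|n IH] f mf f0.
  by rewrite expr0 mul1e; apply: eq_integral => x _; rewrite !(thinmx0 (_ : 'rV_0)).
have mfc : measurable_fun setT (fun p => f (rV_cons p)).
  by apply: measurableT_comp => //; exact: measurable_rV_cons.
have mfa a : measurable_fun setT (fun x => f (rV_cons (a, x))).
  exact: (measurableT_comp mfc (measurable_pair1 a)).
have mfs : measurable_fun setT (fun x : 'rV[R]_n.+1 => f (s *: x)).
  by apply: measurableT_comp => //; exact: measurable_scale_rV.
rewrite !ge0_integral_lebesgue_rVS//.
have mH := measurable_integral_rV_cons mf f0.
rewrite -(ge0_integral_lebesgue_scale s0 mH); last first.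
  by move=> a; apply: integral_ge0.
rewrite exprSr mulrC EFinM -muleA; congr (_ * _).
rewrite -ge0_integralZl//; last 3 first.
- exact: measurable_integral_rV_cons mfs (fun=> f0 _).
- by move=> a _; exact: integral_ge0.
- by rewrite lee_fin exprn_ge0 ?ltW.
apply: eq_integral => a _; rewrite -[RHS]IH//.
by congr (_ * _); apply: eq_integral => x _; rewrite rV_consZ.
Qed.

(** Positive dimension is essential: in dimension 0 the measure is a Dirac mass. It lets the polar
    formula discard the origin. *)
Lemma lebesgue_rV_set0 n : lebesgue_rV n.+1 [set 0%R : 'rV[R]_n.+1] = 0.
Proof.
have m0 := @measurable_rV_set0 R n.
have -> : lebesgue_rV n.+1 [set 0%R] = (mu \x lebesgue_rV n) ([set 0%R] `*` [set 0%R]).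
  rewrite /= /pushforward; congr (_ _); apply/seteqP; split => -[a x]/=.
    move=> E; have := congr1 (@rV_uncons R n) E; rewrite rV_consK /rV_uncons.
    by case=> -> ->; rewrite mxE; split => //; apply/rowP => i; rewrite !mxE.
  move=> [-> ->]; apply/rowP => i; rewrite [RHS]mxE; case: (unliftP ord0 i) => [j|] ->.
    by rewrite !rV_consS/= mxE.
  by rewrite !rV_cons0.
by rewrite product_measure1E// [X in X * _](lebesgue_measure_set1 0%R) mul0e.
Qed.

Lemma measurable_rV_box n (r : R) :
  measurable [set x : 'rV[R]_n | forall i, `|x ord0 i| <= r]%R.
Proof.
rewrite (_ : mkset _ = \bigcap_(i in [set: 'I_n])
    ((fun x : 'rV[R]_n => x ord0 i) @^-1` `[(- r)%R, r]%classic)); last first.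
  apply/seteqP; split => x /= xr i => [_|]; last have := xr i I;
    by rewrite /= in_itv/= -ler_norml.
apply: fin_bigcap_measurable => // i _; rewrite -[X in measurable X]setTI.
exact: measurable_coord.
Qed.

Lemma lebesgue_rV_box_lty n (r : R) :
  lebesgue_rV n [set x : 'rV[R]_n | forall i, `|x ord0 i| <= r]%R < +oo.
Proof.
elim: n => [|n IH]; first by rewrite /= diracE ltry.
have -> : lebesgue_rV n.+1 [set x : 'rV[R]_n.+1 | forall i, `|x ord0 i| <= r]%R =
  (mu \x lebesgue_rV n) (`[(- r)%R, r]%classic `*` [set x : 'rV[R]_n | forall i, `|x ord0 i| <= r]%R).
  rewrite /= /pushforward; congr (_ _); apply/seteqP; split => -[a x]/=.
    move=> ax; split; first by have := ax ord0; rewrite rV_cons0 in_itv/= -ler_norml.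
    by move=> i; have := ax (lift ord0 i); rewrite rV_consS.
  move=> [ar xr] i; case: (unliftP ord0 i) => [j|] ->.
    by rewrite rV_consS.
  by rewrite rV_cons0/= ler_norml.
rewrite product_measure1E//; last exact: measurable_rV_box.
apply: lte_mul_pinfty => //.
by rewrite /= [X in X \is a fin_num]lebesgue_measure_itv/=; case: ifP.
Qed.

End lebesgue_rV_integral.

Section norm2_theory.
Context {R : realType} {n : nat}.
Implicit Types x : 'rV[R]_n.

Lemma norm2_ge0 x : 0 <= norm2 x.
Proof. exact: sqrtr_ge0. Qed.

Lemma norm2Z (s : R) x : 0 <= s -> norm2 (s *: x) = s * norm2 x.
Proof.
move=> s0; rewrite /norm2 (_ : dotrv _ _ = s ^+ 2 * dotrv x x).
  by rewrite sqrtrM ?sqr_ge0// sqrtr_sqr ger0_norm.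
rewrite /dotrv mulr_sumr; apply: eq_bigr => i _; rewrite !mxE; ring.
Qed.

Lemma norm2_gt0 x : x != 0 -> 0 < norm2 x.
Proof.
move=> x0; rewrite sqrtr_gt0 /dotrv lt_neqAle eq_sym sumr_ge0 ?andbT; last first.
  by move=> i _; rewrite -expr2 sqr_ge0.
apply: contraNneq x0 => /eqP; rewrite psumr_eq0; last first.
  by move=> i _; rewrite -expr2 sqr_ge0.
move=> /allP xi; apply/eqP/rowP => i; rewrite mxE; apply/eqP.
by have := xi i; rewrite mem_index_enum -expr2 sqrf_eq0 => /(_ isT).
Qed.

End norm2_theory.

Section power_tail.
Context {R : realType}.
Local Open Scope ereal_scope.
Notation mu := (@lebesgue_measure R).

Lemma integral_powR_tail (N r : R) : (1 <= N)%R -> (0 < r)%R ->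
  \int[mu]_(s in `[r, +oo[) (N * s `^ (- N - 1))%:E = (r `^ (- N))%:E.
Proof.
move=> N1 r0; have N0 : (0 < N)%R by exact: lt_le_trans N1.
pose F (s : R) := (- s `^ (- N))%R.
have dF (s : R) : (0 < s)%R -> is_derive s 1%R F (N * s `^ (- N - 1))%R.
  move=> s0; have := is_deriveN (is_derive1_powR (- N) s0).
  by rewrite mulNr opprK.
have cF (s : R) : (0 < s)%R -> {for s, continuous F}.
  by move=> /dF[+ _] => /derivable1_diffP/differentiable_continuous.
rewrite (@ge0_continuous_FTC2y _ _ F _ 0).
- by rewrite -EFinB /F sub0r opprK.
- by move=> s rs; rewrite mulr_ge0 ?powR_ge0// ltW.
- apply: continuous_in_subspaceT => s /set_mem/=; rewrite in_itv/= andbT => rs.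
  have s0 : (0 < s)%R by exact: lt_le_trans rs.
  have := is_derive1_powR (- N - 1) s0 => -[+ _].
  move=> /derivable1_diffP/differentiable_continuous cs.
  by apply: continuousM cs; exact: cst_continuous.
- rewrite -oppr0; apply: cvgN.
  under eq_fun do rewrite powRN.
  apply/gtr0_cvgV0.
    by near=> s; apply: powR_gt0; near: s; exact: nbhs_pinfty_gt.
  apply: (@ger_cvgy _ _ _ _ id); last exact: cvg_id.
  near=> s; have s1 : (1 <= s)%R by near: s; exact: nbhs_pinfty_ge.
  rewrite -[X in (X <= _)%R]powRr1 ?(le_trans ler01)//.
  by rewrite ler_powR.
- by move=> s rs; have [] := dF s (lt_trans r0 rs).
- exact/cvg_at_right_filter/cF.
- move=> s; rewrite in_itv/= andbT => rs; have [_ <-] := dF s (lt_trans r0 rs).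
  by rewrite derive1E.
Unshelve. all: by end_near. Qed.

End power_tail.

(** * Polar coordinates by averaging over dilations *)

Section polar_coordinates.
Context {R : realType} (n : nat).
Local Open Scope ereal_scope.
Notation mu := (@lebesgue_measure R).
Notation leb := (@lebesgue_rV R n.+1).
Notation V := 'rV[R]_n.+1.

(* The density, in (x, s), of the average of Lebesgue measure over dilations. *)
Definition polar_weight (x : V) (s : R) : R :=
  (n.+1%:R * norm2 x ^+ n.+1 * \1_unit_ball2 x * (s `^ n%:R * \1_(`]0%R, +oo[) s))%R.

(* polar_weight after the substitution y = s x. *)
Let dual_weight (y : V) (s : R) : R :=
  (n.+1%:R * norm2 y ^+ n.+1 * (s `^ (- n.+1%:R - 1) * \1_(`]0%R, +oo[) s) *
   \1_(`[0%R, +oo[) (s - norm2 y))%R.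

Lemma polar_weight_ge0 x s : (0 <= polar_weight x s)%R.
Proof. by rewrite /polar_weight !mulr_ge0 ?exprn_ge0 ?norm2_ge0 ?powR_ge0. Qed.

Let dual_weight_ge0 y s : (0 <= dual_weight y s)%R.
Proof. by rewrite /dual_weight !mulr_ge0 ?exprn_ge0 ?norm2_ge0 ?powR_ge0. Qed.

Lemma measurable_powR_indic (a : R) :
  measurable_fun setT (fun s : R => s `^ a * \1_(`]0%R, +oo[) s)%R.
Proof.
by apply: measurable_funM; [exact: measurable_powR|exact: measurable_indic].
Qed.

Lemma measurable_polar_weight :
  measurable_fun setT (fun p : V * measurableTypeR R => polar_weight p.1 p.2).
Proof.
apply: measurable_funM.
  apply: measurable_funM.
    apply: measurable_funM => //; apply: measurable_funX.
    exact: (measurableT_comp measurable_norm2 measurable_fst).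
  apply: (measurableT_comp _ measurable_fst).
  exact: measurable_indic measurable_unit_ball2.
exact: (measurableT_comp (measurable_powR_indic n%:R) measurable_snd).
Qed.

Let measurable_dual_weight :
  measurable_fun setT (fun p : V * measurableTypeR R => dual_weight p.1 p.2).
Proof.
apply: measurable_funM.
  apply: measurable_funM.
    apply: measurable_funM => //; apply: measurable_funX.
    exact: (measurableT_comp measurable_norm2 measurable_fst).
  exact: (measurableT_comp (measurable_powR_indic _) measurable_snd).
apply: measurableT_comp; first exact: measurable_indic.
apply: measurable_funB => //.
exact: (measurableT_comp measurable_norm2 measurable_fst).
Qed.

Lemma measurable_scale2_rV :
  measurable_fun setT (fun p : V * measurableTypeR R => p.2 *: p.1).
Proof.
apply: measurable_fun_rVP => i; under eq_fun do rewrite mxE.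
apply: measurable_funM => //.
exact: (measurableT_comp (measurable_coord i) measurable_fst).
Qed.

(** For y = s x the constraint |y| <= s becomes |x| <= 1. The exponent of [s] is n+1 from the
    Jacobian, n+1 from the norm and -(n+1)-1 from the weight, in total n. *)
Let dual_weight_scale (s : R) (x : V) : (0 < s)%R ->
  (s ^+ n.+1 * dual_weight (s *: x) s = polar_weight x s)%R.
Proof.
move=> s0; rewrite /dual_weight /polar_weight norm2Z ?ltW//.
have -> : \1_(`[0%R, +oo[) (s - s * norm2 x)%R = \1_unit_ball2 x :> R.
  rewrite !indicE; congr (_%:R); congr nat_of_bool; apply/idP/idP.
    by rewrite !inE/= in_itv/= andbT /unit_ball2/= subr_ge0 ger_pMr.
  by rewrite !inE/= in_itv/= andbT /unit_ball2/= subr_ge0 ger_pMr.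
have -> : (s `^ n%:R = s ^+ n.+1 * s ^+ n.+1 * s `^ (- n.+1%:R - 1))%R.
  rewrite -(powR_mulrn n.+1 (ltW s0)) -!gt0_powRD//; congr (powR _ _).
  by rewrite -natr1; ring.
by rewrite exprMn; ring.
Qed.

Let integral_dual_weight (y : V) : y != 0%R ->
  \int[mu]_s (dual_weight y s)%:E = 1.
Proof.
move=> y0; have ny0 := norm2_gt0 y0.
have := @integral_powR_tail R n.+1%:R (norm2 y).
rewrite ler1n => /(_ isT ny0) I1.
transitivity ((norm2 y ^+ n.+1)%:E * (norm2 y `^ (- n.+1%:R))%:E); last first.
  rewrite -EFinM powRN powR_mulrn ?norm2_ge0// mulfV// expf_neq0//.
  exact: lt0r_neq0.
rewrite -I1 -ge0_integralZl//; last 3 first.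
- apply/measurable_EFinP; apply: measurable_funM => //.
  by apply: measurable_funTS; exact: measurable_powR.
- by move=> s _; rewrite lee_fin mulr_ge0// powR_ge0.
- by rewrite lee_fin exprn_ge0// norm2_ge0.
rewrite [RHS]integral_mkcond; apply: eq_integral => s _.
rewrite patchE /dual_weight !indicE.
have [sD|] := boolP (s \in _).
  rewrite mem_set/=; last first.
    by move: sD; rewrite inE/= !in_itv/= !andbT; exact: lt_le_trans.
  rewrite mem_set/=; last first.
    by move: sD; rewrite inE/= !in_itv/= !andbT subr_ge0.
  by rewrite -EFinM; congr (_%:E); ring.
rewrite notin_setE/= in_itv/= andbT => sD.
rewrite (_ : (s - norm2 y \in _)%R = false) ?mulr0//.
by apply: memNset; rewrite /= in_itv/= andbT subr_ge0.
Qed.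

(** Insert the factor 1, written as the integral of [dual_weight y] over s; exchange the integrals,
    substitute y = s x for fixed s, and exchange back. *)
Lemma ge0_integral_polar (f : V -> \bar R) :
  measurable_fun setT f -> (forall x, 0 <= f x) ->
  \int[leb]_x f x =
  \int[leb]_x \int[mu]_s ((polar_weight x s)%:E * f (s *: x)).
Proof.
move=> mf f0.
have mE (k : V -> R -> R) (h : V * measurableTypeR R -> V) :
    measurable_fun setT (fun p : V * measurableTypeR R => k p.1 p.2) ->
    measurable_fun setT h ->
    measurable_fun setT (fun p : V * measurableTypeR R => (k p.1 p.2)%:E * f (h p)).
  move=> mk mh; apply: emeasurable_funM; first exact/measurable_EFinP.
  exact: (measurableT_comp mf mh).
have mdual := mE _ _ measurable_dual_weight measurable_fst.
have mpolar := mE _ _ measurable_polar_weight measurable_scale2_rV.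
rewrite (@fubini_tonelli _ _ V (measurableTypeR R) R leb mu _ mpolar); last first.
  by move=> p; rewrite mule_ge0// lee_fin polar_weight_ge0.
transitivity (\int[mu]_s \int[leb]_y ((dual_weight y s)%:E * f y)).
  rewrite -(@fubini_tonelli _ _ V (measurableTypeR R) R leb mu _ mdual); last first.
    by move=> p; rewrite mule_ge0// lee_fin dual_weight_ge0.
  (* The origin is removed because [dual_weight 0] vanishes identically and so does not integrate to
     1. *)
  have m0 := @measurable_rV_set0 R n.+1.
  rewrite (ge0_negligible_integral m0 _ mf _ (lebesgue_rV_set0 n))//.
  rewrite [RHS](ge0_negligible_integral m0 _ _ _ (lebesgue_rV_set0 n))//; last 2 first.
  - apply: (@measurable_fun_fubini_tonelli_F _ _ V (measurableTypeR R) R mu _ mdual).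
    by move=> p; rewrite mule_ge0// lee_fin dual_weight_ge0.
  - move=> y _; apply: integral_ge0 => s _.
    by rewrite mule_ge0// lee_fin dual_weight_ge0.
  apply: eq_integral => y; rewrite inE => -[_ /eqP y0].
  rewrite /= ge0_integralZr//; last 2 first.
  - apply/measurable_EFinP.
    exact: (measurableT_comp measurable_dual_weight (measurable_pair1 y)).
  - by move=> s _; rewrite lee_fin dual_weight_ge0.
  by rewrite integral_dual_weight// mul1e.
apply: eq_integral => s _ /=.
have [s0|s0] := ltP 0%R s.
  have mds : measurable_fun setT (fun y => (dual_weight y s)%:E * f y).
    exact: (measurableT_comp mdual (measurable_pair2 s)).
  rewrite -(ge0_integral_lebesgue_rV_scale s0 mds); last first.
    by move=> y; rewrite mule_ge0// lee_fin dual_weight_ge0.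
  rewrite -ge0_integralZl//; last 3 first.
  - by apply: (measurableT_comp mds); exact: measurable_scale_rV.
  - by move=> y _; rewrite mule_ge0// lee_fin dual_weight_ge0.
  - by rewrite lee_fin exprn_ge0// ltW.
  apply: eq_integral => x _; rewrite muleA -EFinM dual_weight_scale//.
have i0 : \1_(`]0%R, +oo[) s = 0%R :> R.
  by rewrite indicE memNset//= in_itv/= andbT ltNge s0.
rewrite integral0_eq; last by move=> y _; rewrite /dual_weight i0 !(mulr0, mul0r) mul0e.
by rewrite integral0_eq// => x _; rewrite /polar_weight i0 !mulr0 mul0e.
Qed.

End polar_coordinates.

(** * From estimates on rays to an integral over the sphere *)

Section polar_bounds.
Context {R : realType} (n : nat).
Local Open Scope ereal_scope.
Notation mu := (@lebesgue_measure R).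
Notation leb := (@lebesgue_rV R n.+1).
Notation V := 'rV[R]_n.+1.

(** The polar formula for nonnegative functions is applied to the positive and negative parts of
    [f]; integrability makes both polar integrals integrable, so their difference can be recombined
    ray by ray. *)
Lemma abse_integral_polar_le (f : V -> R) (B : V -> \bar R) :
  leb.-integrable setT (EFin \o f) -> measurable_fun setT B ->
  (forall x, `|\int[mu]_s (polar_weight x s * f (s *: x))%:E| <= B x) ->
  `|\int[leb]_x (f x)%:E| <= \int[leb]_x B x.
Proof.
move=> fi mB fB; have mf := measurable_int _ fi.
pose P (g : V -> \bar R) (x : V) :=
  \int[mu]_s ((polar_weight x s)%:E * g (s *: x)).
have mP (g : V -> \bar R) : measurable_fun setT g -> (forall x, 0 <= g x) ->
    measurable_fun setT (P g).
  move=> mg g0.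
  apply: (@measurable_fun_fubini_tonelli_F _ _ V (measurableTypeR R) R mu
    (fun p => (polar_weight p.1 p.2)%:E * g (p.2 *: p.1))).
    apply: emeasurable_funM.
      by apply/measurable_EFinP; exact: measurable_polar_weight.
    exact: (measurableT_comp mg (@measurable_scale2_rV R n)).
  by move=> p; rewrite mule_ge0// lee_fin polar_weight_ge0.
have P0 (g : V -> \bar R) : (forall x, 0 <= g x) -> forall x, 0 <= P g x.
  move=> g0 x; apply: integral_ge0 => s _.
  by rewrite mule_ge0// lee_fin polar_weight_ge0.
have iP (g : V -> \bar R) : (forall x, 0 <= g x) -> leb.-integrable setT g ->
    leb.-integrable setT (P g).
  move=> g0 gi; have mg := measurable_int _ gi.
  apply/integrableP; split; first exact: mP.
  under eq_integral do rewrite gee0_abs ?P0//.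
  rewrite -ge0_integral_polar//.
  by have /integrableP[_] := gi; under eq_integral do rewrite gee0_abs//.
have mfp := measurable_funepos mf; have mfn := measurable_funeneg mf.
rewrite integralE (ge0_integral_polar mfp); last by move=> x; exact: funepos_ge0.
rewrite (ge0_integral_polar mfn); last by move=> x; exact: funeneg_ge0.
have ip := iP _ (funepos_ge0 (EFin \o f)) (integrable_funepos measurableT fi).
have im := iP _ (funeneg_ge0 (EFin \o f)) (integrable_funeneg measurableT fi).
rewrite -(integralB measurableT ip im).
have mPP : measurable_fun setT (P (EFin \o f)^\+ \- P (EFin \o f)^\-).
  by apply: emeasurable_funB; [exact: measurable_int ip|exact: measurable_int im].
apply: le_trans (le_abse_integral _ _ mPP) _ => //.
apply: ge0_le_integral => //; first exact: measurableT_comp.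
move=> x _; apply: le_trans (fB x); rewrite le_eqVlt; apply/orP; left; apply/eqP.
(* The weight is nonnegative, so it passes through positive and negative parts. *)
congr (`| _ |); rewrite [RHS]integralE; congr (_ - _).
  apply: eq_integral => s _; rewrite !funeposE.
  by rewrite maxe_pMr ?lee_fin ?polar_weight_ge0// mule0.
apply: eq_integral => s _; rewrite !funenegE.
by rewrite maxe_pMr ?lee_fin ?polar_weight_ge0// mule0 muleN.
Qed.

Lemma measurable_unit_sphere2 : measurable (@unit_sphere2 R n.+1).
Proof.
rewrite (_ : unit_sphere2 = norm2 @^-1` [set 1%R])//.
by rewrite -[X in measurable X]setTI; exact: measurable_norm2.
Qed.

(** The surface measure is the image under [radial_proj] of Lebesgue measure restricted to the ball,
    scaled by the dimension. After this change of variables, shrinking the domain to a part of the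
    ball only lowers the integral, and there the restricted measure is Lebesgue measure. *)
Lemma surface_integral_ge (g : V -> \bar R) :
  measurable_fun setT g -> (forall x, 0 <= g x) ->
  n.+1%:R%:E *
    \int[leb]_(x in unit_ball2 `&` radial_proj @^-1` unit_sphere2) g (radial_proj x)
  <= \int[surface_measure n.+1]_(w in unit_sphere2) g w.
Proof.
move=> mg g0.
pose ballr := mrestr leb (@measurable_unit_ball2 R n.+1).
pose cone : {measure set V -> \bar R} :=
  measure_function_pushforward__canonical__measure_function_Measure
    ballr (@measurable_radial_proj R n.+1).
have mS := measurable_unit_sphere2.
have mpS : measurable (radial_proj @^-1` (@unit_sphere2 R n.+1)).
  by rewrite -[X in measurable X]setTI; exact: measurable_radial_proj.
have mgp : measurable_fun setT (g \o @radial_proj R n.+1).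
  by apply: measurableT_comp => //; exact: measurable_radial_proj.
have -> : \int[surface_measure n.+1]_(w in unit_sphere2) g w =
    \int[mscale (NngNum (ler0n R n.+1)) cone]_(w in unit_sphere2) g w.
  apply: eq_measure_integral => A mA _.
  by rewrite /= /surface_measure /mscale/= /pushforward /mrestr setIC.
rewrite ge0_integral_mscale//; last exact: measurable_funTS.
rewrite lee_pmul2l//.
rewrite (ge0_integral_pushforward (@measurable_radial_proj R n.+1))//; last first.
  exact: measurable_funTS.
set D := _ `&` _.
have mD : measurable D by apply: measurableI => //; exact: measurable_unit_ball2.
apply: (@le_trans _ _ (\int[ballr]_(x in D) (g \o radial_proj) x)); last first.
  apply: ge0_subset_integral => //; first exact: measurable_funTS.
  - by move=> x _; exact: g0.
  - exact: subIsetr.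
rewrite le_eqVlt; apply/orP; left; apply/eqP.
apply: eq_measure_integral => A mA AD; rewrite /ballr /= /mrestr.
by congr (leb _); apply/esym/setIidl; apply: subset_trans AD _; exact: subIsetl.
Qed.

End polar_bounds.

(** * Oscillatory integrals with homogeneous phases *)

Section compact_support.
Context {R : realType} {n : nat}.
Implicit Types (x y : 'rV[R]_n) (f : 'rV[R]_n -> R).

Lemma ler_coord_norm x i : `|x ord0 i| <= `|x|.
Proof.
rewrite [leRHS]mx_normrE.
exact: (le_bigmax 0 (fun ij : 'I_1 * 'I_n => `|x ij.1 ij.2|) (ord0, i)).
Qed.

Lemma continuous_ball_bounded f (rho : R) : continuous f ->
  exists2 B, 0 <= B & forall y, `|y| <= rho -> `|f y| <= B.
Proof.
move=> cf; pose A := [set y : 'rV[R]_n | `|y| <= rho].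
have cA : compact A.
  apply: bounded_closed_compact.
    by exists rho; split; [exact: num_real|move=> r rr y /= /le_trans; apply; exact: ltW].
  rewrite (_ : A = (fun y => `|y|) @^-1` `]-oo, rho]).
    apply: closed_comp; last exact: interval_closed.
    by move=> y _; exact: norm_continuous.
  by apply/seteqP; split => y /=; rewrite in_itv.
have /compact_bounded[B [_ fB]] : compact (f @` A).
  by apply: continuous_compact => //; exact: continuous_subspaceT.
exists (`|B| + 1); first by rewrite addr_ge0.
move=> y yrho; apply: (fB (`|B| + 1)); last by exists y.
by rewrite (le_lt_trans (ler_norm B))// ltrDl.
Qed.

Lemma integrable_compact_support f (rho : R) : measurable_fun setT f ->
  (exists B, forall x, `|f x| <= B) -> (forall x, rho <= `|x| -> f x = 0) ->
  (lebesgue_rV n).-integrable setT (EFin \o f).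
Proof.
move=> mf [B fB] f0.
pose A := [set x : 'rV[R]_n | forall i, `|x ord0 i| <= rho].
have mA : measurable A := measurable_rV_box _.
suff : (lebesgue_rV n).-integrable setT ((EFin \o f) \_ A).
  rewrite (_ : (EFin \o f) \_ A = EFin \o f)//; apply/funext => x.
  rewrite patchE; case: ifPn => // /negP; rewrite inE => xA.
  rewrite /= f0//; apply: contrapT => /negP; rewrite -ltNge => xrho; apply: xA => i.
  exact: le_trans (ler_coord_norm x i) (ltW xrho).
apply/(integrable_mkcond _ mA).1; apply: measurable_bounded_integrable => //.
- exact: lebesgue_rV_box_lty.
- exact: measurable_funTS.
- exists B; split; first exact: num_real.
  by move=> r Br x _; apply: le_trans (fB x) (ltW Br).
Qed.

End compact_support.

Section homogeneous_forms.
Context {R : realType} {n l : nat} (m : R) (phi : 'I_l -> 'rV[R]_n -> R).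
Hypothesis phi_continuous :
  forall j (x : 'rV[R]_n), x != 0 -> {for x, continuous (phi j)}.
Hypothesis phi_homogeneous : forall j, homogeneous m (phi j).
Implicit Types (lambda : 'rV[R]_l) (xi x : 'rV[R]_n).

Lemma Phi_lambdaE lambda x :
  Phi_lambda phi lambda x = \sum_j lambda ord0 j * phi j x.
Proof. by apply: eq_bigr => j _; rewrite mxE mulrC. Qed.

Lemma Phi_lambdaZ lambda (s : R) x : 0 < s -> x != 0 ->
  Phi_lambda phi lambda (s *: x) = s `^ m * Phi_lambda phi lambda x.
Proof.
move=> s0 x0; rewrite !Phi_lambdaE mulr_sumr; apply: eq_bigr => j _.
by rewrite (phi_homogeneous j).2// mulrCA.
Qed.

Lemma measurable_Phi_lambda lambda :
  measurable_fun setT (Phi_lambda phi lambda).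
Proof.
rewrite (funext (Phi_lambdaE lambda)).
apply: measurable_sum => j; apply: measurable_funM => //.
exact: continuous_off0_measurable_rV (@phi_continuous j).
Qed.

Lemma measurable_phase xi lambda (c : R) :
  measurable_fun setT (fun x => dotrv x xi + Phi_lambda phi lambda x + c).
Proof.
apply: measurable_funD => //; apply: measurable_funD.
  by apply: measurable_sum => i; apply: measurable_funM => //; exact: measurable_coord.
exact: measurable_Phi_lambda.
Qed.

Lemma measurable_inve_powR lambda (a : R) :
  measurable_fun setT
    (fun w => ((`|Phi_lambda phi lambda w| `^ a)%:E)^-1)%E.
Proof.
have mp : measurable_fun setT (fun w => `|Phi_lambda phi lambda w| `^ a).
  apply: (measurableT_comp (measurable_powR a)).
  by apply: measurableT_comp => //; exact: measurable_Phi_lambda.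
under eq_fun do rewrite inver.
apply: measurable_fun_ifT => //; first exact: measurable_fun_eqr.
apply/measurable_EFinP.
rewrite (_ : (fun _ => _) = fun w => (`|Phi_lambda phi lambda w| `^ a) `^ (-1)).
  exact: (measurableT_comp (measurable_powR (-1)) mp).
by apply/funext => w; rewrite powR_inv1// powR_ge0.
Qed.

Lemma integrable_cos_phase (psi : 'rV[R]_n -> R) (rho : R) xi lambda (c : R) :
  continuous psi -> (forall x, rho <= `|x| -> psi x = 0) ->
  (lebesgue_rV n).-integrable setT
    (EFin \o (fun x => cos (dotrv x xi + Phi_lambda phi lambda x + c) * psi x)).
Proof.
move=> cpsi psi0; apply: (@integrable_compact_support _ _ _ rho).
- apply: measurable_funM; last first.
    by apply: continuous_off0_measurable_rV => x _; exact: cpsi.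
  apply: measurableT_comp; last exact: measurable_phase.
  by apply: continuous_measurable_fun; exact: continuous_cos.
- have [B B0 psiB] := continuous_ball_bounded rho cpsi.
  exists B => x; have [xrho|/ltW xrho] := leP rho `|x|.
    by rewrite psi0// mulr0 normr0.
  by rewrite normrM (le_trans _ (psiB x xrho))// ler_piMl// cos_max.
- by move=> x xrho; rewrite psi0// mulr0.
Qed.

End homogeneous_forms.

(** * The estimate for a real amplitude *)

Section real_amplitude.
Context {R : realType} {n l : nat} (m : R) (phi : 'I_l -> 'rV[R]_n.+1 -> R).
Hypothesis m_ge : (2 * n.+1)%:R <= m.
Hypothesis phi_continuous :
  forall j (x : 'rV[R]_n.+1), x != 0 -> {for x, continuous (phi j)}.
Hypothesis phi_homogeneous : forall j, homogeneous m (phi j).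
Implicit Types (lambda : 'rV[R]_l) (xi x : 'rV[R]_n.+1).
Notation mu := (@lebesgue_measure R).

(** On the ray through [x] the phase is a s + b s^m + c with b = [Phi_lambda phi lambda x]. The
    bound does not depend on the length of [x]: the slope of the amplitude grows like |x| while its
    support shrinks like 1/|x|, and the power of [norm2 x] in the weight cancels the one in
    |b|^(-(n+1)/m). *)
Lemma polar_ray_bound (psi : 'rV[R]_n.+1 -> R) (rho M L : R) xi lambda (c : R) x :
  0 < rho -> 0 < M ->
  (forall x v, is_derive x v psi (\sum_i v ord0 i * partial i psi x)) ->
  (forall x, rho <= `|x| -> psi x = 0) ->
  (forall x, `|psi x| <= M) ->
  (forall i x, `|x| <= rho -> `|partial i psi x| <= L) ->
  x != 0 -> norm2 x <= 1 ->
  (`|\int[mu]_s (polar_weight x s * (cos (dotrv (s *: x) xi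
       + Phi_lambda phi lambda (s *: x) + c) * psi (s *: x)))%:E| <=
   (n.+1%:R * (M + (2 * pi + 1) * (n.+1%:R * L * rho)))%:E *
   ((`|Phi_lambda phi lambda (radial_proj x)| `^ (n.+1%:R / m))%:E)^-1)%E.
Proof.
move=> rho0 M0 dpsi psi0 psiM psiL x0 x1.
have L0 : 0 <= L.
  by apply: le_trans (normr_ge0 _) (psiL ord0 0 _); rewrite normr0 ltW.
have r0 : 0 < norm2 x := norm2_gt0 x0.
have m0 : 0 < m by apply: lt_le_trans m_ge; rewrite ltr0n.
set C := M + _; have C0 : 0 < C.
  rewrite ltr_pwDl// mulr_ge0 ?mulr_ge0 ?(ltW rho0)//.
  by have := pi_ge0 R; lra.
(* In the degenerate direction the right-hand side is +oo, thanks to a strictly positive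
   constant. *)
have [p0|p0] := eqVneq (Phi_lambda phi lambda (radial_proj x)) 0.
  rewrite p0 normr0 powR0; last by rewrite mulf_neq0// invr_eq0 lt0r_neq0.
  by rewrite inve0 gt0_muley ?leey// lte_fin mulr_gt0.
pose kappa : R := n.+1%:R * norm2 x ^+ n.+1.
have kappa0 : 0 <= kappa by rewrite mulr_ge0// exprn_ge0// norm2_ge0.
have nx0 : 0 < `|x| by rewrite normr_gt0.
pose a := dotrv x xi.
pose b := Phi_lambda phi lambda x.
have xE : x = norm2 x *: radial_proj x.
  by rewrite /radial_proj scalerA mulfV ?scale1r// lt0r_neq0.
have rp0 : radial_proj x != 0.
  by rewrite scaler_eq0 negb_or invr_eq0 lt0r_neq0// x0.
have bE : b = norm2 x `^ m * Phi_lambda phi lambda (radial_proj x).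
  by rewrite /b {1}xE (Phi_lambdaZ phi_homogeneous).
have b0 : b != 0 by rewrite bE mulf_neq0// lt0r_neq0// powR_gt0.
pose g (s : R) : R := kappa * psi (s *: x).
pose g' (s : R) : R := kappa * \sum_i x ord0 i * partial i psi (s *: x).
pose T := rho / `|x|.
have T0 : 0 < T by rewrite divr_gt0.
have dg (s : R) : 0 < s -> is_derive s 1 g (g' s).
  move=> _; apply: is_deriveZ.
  have -> : (fun t : R => psi (t *: x)) = (fun t => psi (0 + t *: x)).
    by apply/funext => t; rewrite add0r.
  by apply: is_derive_line; rewrite add0r; exact: dpsi.
have gL (s : R) : 0 < s -> s <= T -> `|g' s| <= kappa * (n.+1%:R * `|x| * L).
  move=> s0 sT; rewrite /g' normrM (ger0_norm kappa0) ler_wpM2l//.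
  apply: le_trans (ler_norm_sum _ _ _) _.
  have sx : `|s *: x| <= rho by rewrite normrZ gtr0_norm// -ler_pdivlMr.
  apply: le_trans (_ : \sum_(i < n.+1) `|x| * L <= _).
    apply: ler_sum => i _; rewrite normrM ler_pM//; first exact: ler_coord_norm.
    exact: psiL.
  by rewrite sumr_const card_ord -mulrA mulr_natl.
have gM (s : R) : 0 < s -> `|g s| <= kappa * M.
  by move=> _; rewrite /g normrM (ger0_norm kappa0) ler_wpM2l.
have gT (s : R) : T <= s -> g s = 0.
  move=> Ts; rewrite /g psi0 ?mulr0// normrZ -ler_pdivrMr// (le_trans Ts)//.
  exact: ler_norm.
have N1 : 1 <= n.+1%:R :> R by rewrite ler1n.
have Nm : 2 * n.+1%:R <= m by rewrite -natrM.
have := radial_integral_bound a c N1 Nm b0 T0 dg gL gM gT.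
have -> : (\int[mu]_(s in `]0%R, +oo[)
    (cos (a * s + b * s `^ m + c) * s `^ (n.+1%:R - 1) * g s)%:E =
  \int[mu]_s (polar_weight x s * (cos (dotrv (s *: x) xi
       + Phi_lambda phi lambda (s *: x) + c) * psi (s *: x)))%:E)%E.
  rewrite integral_mkcond; apply: eq_integral => s _; rewrite patchE.
  rewrite /polar_weight !indicE (mem_set (x1 : unit_ball2 x)).
  have [s0|s0] := ltP 0 s; last first.
    have sN : ~ `]0, +oo[%classic s by rewrite /= in_itv/= andbT ltNge s0.
    rewrite ifF; last exact: memNset.
    by rewrite (_ : (s \in _) = false) ?mulr0 ?mul0r//; exact: memNset.
  rewrite ifT; last by rewrite inE/= in_itv/= s0.
  rewrite (_ : (s \in _) = true); last by apply: mem_set; rewrite /= in_itv/= s0.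
  rewrite (Phi_lambdaZ phi_homogeneous)// -/b.
  have -> : dotrv (s *: x) xi = a * s.
    by rewrite /a /dotrv mulr_suml; apply: eq_bigr => i _; rewrite mxE; ring.
  have -> : n.+1%:R - 1 = n%:R :> R by rewrite -natr1 addrK.
  congr (_%:E); rewrite /g /kappa [b * _]mulrC /= !mulr1.
  rewrite -[LHS]mulrA [RHS]mulrCA; congr (_ * _).
  by rewrite [LHS]mulrA; congr (_ * _); exact: mulrC.
move=> /le_trans; apply.
rewrite inver powR_eq0 normr_eq0 (negbTE p0)/= -EFinM lee_fin.
(* Homogeneity of degree m turns the factor |x|^m in [b] into exactly |x|^(-(n+1)), the inverse of
   the factor in [kappa]. *)
have -> : `|b| `^ (- (n.+1%:R / m)) = (norm2 x ^+ n.+1)^-1 *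
    (`|Phi_lambda phi lambda (radial_proj x)| `^ (n.+1%:R / m))^-1.
  rewrite bE normrM (ger0_norm (powR_ge0 _ _)) powRN powRM ?powR_ge0// invfM.
  congr (_^-1 * _); rewrite -powRrM mulrC divfK ?lt0r_neq0//.
  by rewrite powR_mulrn// norm2_ge0.
rewrite [leLHS]mulrA ler_wpM2r ?invr_ge0 ?powR_ge0//.
rewrite le_eqVlt; apply/orP; left; apply/eqP.
have rn0 : norm2 x ^+ n.+1 != 0 by rewrite expf_neq0// lt0r_neq0.
by rewrite /C /kappa /T; field; rewrite rn0 lt0r_neq0.
Qed.

(** [polar_ray_bound] is integrated over the ball and compared with the sphere. The shift [c] lets
    one statement cover both cosine and sine. *)
Lemma cos_phase_integral_bound (psi : 'rV[R]_n.+1 -> R) (rho : R) :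
  0 < rho -> smooth_on setT psi -> (forall x, rho <= `|x| -> psi x = 0) ->
  exists2 C : R, 0 < C & forall xi lambda (c : R),
    (`|\int[lebesgue_rV n.+1]_x
        (cos (dotrv x xi + Phi_lambda phi lambda x + c) * psi x)%:E| <=
     C%:E * \int[surface_measure n.+1]_(w in unit_sphere2)
              ((`|Phi_lambda phi lambda w| `^ (n.+1%:R / m))%:E)^-1)%E.
Proof.
move=> rho0 spsi psi0.
have cpsi : continuous psi by move=> x; have [] := spsi [::] x I.
have cdpsi i : continuous (partial i psi) by move=> x; have [] := spsi [:: i] x I.
have ddpsi (i : 'I_n.+1) x : derivable psi x (delta_mx ord0 i).
  by have [_] := spsi [::] x I; exact.
have dpsi := is_derive_continuous_partials ddpsi cdpsi.
have [M0 M00 psiM0] := continuous_ball_bounded rho cpsi.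
(* Adding 1 makes the final constant strictly positive even when [psi] is zero. *)
pose M := M0 + 1.
have Mp : 0 < M by rewrite ltr_wpDl.
have psiM x : `|psi x| <= M.
  have [xrho|/ltW xrho] := leP rho `|x|; first by rewrite psi0// normr0 ltW.
  by rewrite (le_trans (psiM0 x xrho))// lerDl.
have /choice[Li LiP] (i : 'I_n.+1) : exists B, 0 <= B /\
    forall y, `|y| <= rho -> `|partial i psi y| <= B.
  by have [B B0 BP] := continuous_ball_bounded rho (cdpsi i); exists B.
pose L := \sum_i Li i.
have L0 : 0 <= L by apply: sumr_ge0 => i _; have [] := LiP i.
have psiL i x : `|x| <= rho -> `|partial i psi x| <= L.
  move=> xrho; have [_ /(_ x xrho)/le_trans] := LiP i; apply.
  rewrite /L (bigD1 i)//= lerDl; apply: sumr_ge0 => j _; by have [] := LiP j.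
pose C := M + (2 * pi + 1) * (n.+1%:R * L * rho).
have C0 : 0 < C.
  rewrite ltr_pwDl// mulr_ge0 ?mulr_ge0 ?(ltW rho0)//.
  by have := pi_ge0 R; lra.
exists C => // xi lambda c.
pose G w : \bar R := (((`|Phi_lambda phi lambda w| `^ (n.+1%:R / m))%:E)^-1)%E.
have mG : measurable_fun setT G by exact: measurable_inve_powR.
have G0 w : (0 <= G w)%E by rewrite /G inve_ge0 lee_fin powR_ge0.
pose D := unit_ball2 `&` @radial_proj R n.+1 @^-1` unit_sphere2.
have mD : measurable D.
  apply: measurableI; first exact: measurable_unit_ball2.
  rewrite -[X in measurable X]setTI; apply: measurable_radial_proj => //.
  exact: measurable_unit_sphere2.
have mGp : measurable_fun setT (G \o @radial_proj R n.+1).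
  by apply: (measurableT_comp mG); exact: measurable_radial_proj.
have mGD : measurable_fun setT ((G \o @radial_proj R n.+1) \_ D).
  by apply/(measurable_restrictT _ mD); exact: measurable_funTS.
have GD0 x : (0 <= ((G \o @radial_proj R n.+1) \_ D) x)%E.
  by apply: erestrict_ge0 => y _; exact: G0.
have fi := integrable_cos_phase phi_continuous xi lambda c cpsi psi0.
apply: (@le_trans _ _ (\int[lebesgue_rV n.+1]_x
    ((n.+1%:R * C)%:E * ((G \o @radial_proj R n.+1) \_ D) x))%E).
  apply: abse_integral_polar_le => //; first exact: measurable_funeM.
  move=> x; have [xD|xD] := pselect (D x).
    have x0 : x != 0.
      apply/eqP => x0; move: xD; rewrite x0 => -[_].
      rewrite /radial_proj /unit_sphere2/= scaler0 -(scale0r 0) norm2Z// mul0r.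
      by move=> /esym/eqP; rewrite oner_eq0.
    rewrite patchE mem_set//.
    exact: (@polar_ray_bound psi rho M L xi lambda c x rho0 Mp
      dpsi psi0 psiM psiL x0 xD.1).
  (* Outside [D] the weight vanishes: a nonzero point of the ball projects to the sphere, so [x] is
     either the origin, killed by the power of [norm2 x], or outside the ball. *)
  rewrite integral0_eq; first by rewrite abse0 mule_ge0// lee_fin mulr_ge0// ltW.
  move=> s _; suff -> : polar_weight x s = 0 by rewrite mul0r.
  rewrite /polar_weight indicE; have [->|x0] := eqVneq x 0.
    by rewrite -(scale0r 0) norm2Z// mul0r expr0n/= mulr0 !mul0r.
  rewrite memNset ?mulr0 ?mul0r// => x1; apply: xD; split => //.
  rewrite /unit_sphere2/= /radial_proj norm2Z ?invr_ge0 ?norm2_ge0//.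
  by rewrite mulVf// lt0r_neq0// norm2_gt0.
rewrite ge0_integralZl//; last by rewrite lee_fin mulr_ge0// ltW.
rewrite -integral_mkcond mulrC EFinM -muleA lee_pmul2l//.
exact: surface_integral_ge.
Qed.

End real_amplitude.

(** * Reduction of the complex integral to real ones *)

Lemma normc_le_add (R : realType) (z : R[i]) :
  ComplexField.Normc.normc z <= `|complex.Re z| + `|complex.Im z|.
Proof.
case: z => a b /=; rewrite -(ler_pXn2r (n := 2)) ?nnegrE ?sqrtr_ge0 ?addr_ge0//.
rewrite sqr_sqrtr ?addr_ge0 ?sqr_ge0// sqrrD !real_normK ?num_real//.
by rewrite lerD2r lerDl mulrn_wge0// mulr_ge0.
Qed.

Lemma normr_Rintegral_le (d : measure_display) (T : measurableType d)
    (R : realType) (mu : {measure set T -> \bar R}) (f : T -> R) (b : \bar R) :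
  mu.-integrable setT (EFin \o f) -> (`|\int[mu]_x (f x)%:E| <= b)%E ->
  ((`|\int[mu]_x f x|)%:E <= b)%E.
Proof.
move=> fi; apply: le_trans; rewrite /Rintegral -abse_EFin fineK//.
exact: integrable_fin_num.
Qed.

(* x^-1 on extended reals satisfies 0^-1 = +oo, so the integrand is +oo where
   Phi_lambda vanishes; (0 `^ (- a))%R would be 0. *)
Theorem mainTheorem4 (R : realType) (n l : nat) (m : R)
    (phi : 'I_l -> 'rV[R]_n -> R) (psi : 'rV[R]_n -> R[i])
    (n_ge1 : (1 <= n)%N) (l_ge1 : (1 <= l)%N) (m_ge2n : (2 * n)%:R <= m)
    (phi_smooth : forall j, smooth_on [set x | x != 0] (phi j))
    (phi_homogeneous : forall j, homogeneous m (phi j))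
    (psi_cutoff : smooth_cutoff psi) :
  exists2 C : R, 0 < C & forall (xi : 'rV[R]_n) (lambda : 'rV[R]_l),
    ((ComplexField.Normc.normc (oscF phi psi xi lambda))%:E <=
     C%:E * \int[surface_measure n]_(w in unit_sphere2)
              ((`|Phi_lambda phi lambda w| `^ (n%:R / m))%:E)^-1)%E.
Proof.
case: n => [|n] in phi psi n_ge1 m_ge2n phi_smooth phi_homogeneous psi_cutoff *.
  by [].
have [smR smI cpt] := psi_cutoff.
have cphi j (x : 'rV[R]_n.+1) : x != 0 -> {for x, continuous (phi j)}.
  by move=> x0; have [] := phi_smooth j [::] x x0.
have [rho rho0 psi0] : exists2 rho : R, 0 < rho &
    forall x, rho <= `|x| -> psi x = 0.
  have [B [_ psiB]] := compact_bounded cpt.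
  (* The support lies in |x| <= |B| + 1, so one more unit guarantees that [psi] vanishes from this
     radius on. *)
  exists (`|B| + 2); first by rewrite ltr_wpDl.
  move=> x xB; apply: contrapT => /eqP px.
  have := psiB (`|B| + 1); rewrite (le_lt_trans (ler_norm B)) ?ltrDl// => /(_ isT).
  move=> /(_ x) xB'; have {}xB' : `|x| <= `|B| + 1.
    by apply: xB'; apply: subset_closure; exact: px.
  by have := le_trans xB xB'; rewrite lerD2l leNgt ltr1n.
have Re0 x : rho <= `|x| -> complex.Re (psi x) = 0 by move=> /psi0 ->.
have Im0 x : rho <= `|x| -> complex.Im (psi x) = 0 by move=> /psi0 ->.
have [C1 C10 bR] := cos_phase_integral_bound m_ge2n cphi phi_homogeneous rho0 smR Re0.
have [C2 C20 bI] := cos_phase_integral_bound m_ge2n cphi phi_homogeneous rho0 smI Im0.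
(* Four real integrals occur: cosine and sine, each against the real part of [psi] (constant [C1])
   and the imaginary part (constant [C2]). *)
exists (C1 + C2 + (C2 + C1)); first by rewrite !addr_gt0.
move=> xi lambda.
have cR : continuous (fun x => complex.Re (psi x)).
  by move=> x; have [] := smR [::] x I.
have cI : continuous (fun x => complex.Im (psi x)).
  by move=> x; have [] := smI [::] x I.
have iR c := integrable_cos_phase cphi xi lambda c cR Re0.
have iI c := integrable_cos_phase cphi xi lambda c cI Im0.
pose t x := dotrv x xi + Phi_lambda phi lambda x.
have costE x : cos (t x) = cos (t x + 0) by rewrite addr0.
(* The sine integrals become cosine integrals with [c] = -pi/2. *)
have sintE x : sin (t x) = cos (t x + - (pi / 2)) by rewrite cosBpihalf.
have ReE : complex.Re (oscF phi psi xi lambda) =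
    (\int[lebesgue_rV n.+1]_x (cos (t x + 0) * complex.Re (psi x)) -
     \int[lebesgue_rV n.+1]_x (cos (t x + - (pi / 2)) * complex.Im (psi x)))%R.
  rewrite -RintegralB//.
  apply: eq_Rintegral => x _; rewrite -costE -sintE /t Phi_lambdaE.
  by case: (psi x).
have ImE : complex.Im (oscF phi psi xi lambda) =
    (\int[lebesgue_rV n.+1]_x (cos (t x + 0) * complex.Im (psi x)) +
     \int[lebesgue_rV n.+1]_x (cos (t x + - (pi / 2)) * complex.Re (psi x)))%R.
  rewrite -RintegralD//.
  apply: eq_Rintegral => x _; rewrite -costE -sintE /t Phi_lambdaE.
  by case: (psi x).
set J := (\int[_]_(w in _) _)%E.
have J0 : (0 <= J)%E.
  by apply: integral_ge0 => w _; rewrite inve_ge0 lee_fin powR_ge0.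
apply: (@le_trans _ _ ((`|complex.Re (oscF phi psi xi lambda)|
    + `|complex.Im (oscF phi psi xi lambda)|)%:E)%E).
  by rewrite lee_fin normc_le_add.
rewrite ReE ImE !EFinD !ge0_muleDl ?lee_fin ?addr_ge0 ?(ltW C10) ?(ltW C20)//.
have normD (u v : R) (p q : \bar R) : (`|u|%:E <= p -> `|v|%:E <= q ->
    `|u + v|%:E <= p + q)%E.
  by move=> up vq; apply: le_trans (leeD up vq); rewrite -EFinD lee_fin ler_normD.
apply: leeD; apply: normD; rewrite ?normrN; apply: normr_Rintegral_le;
  by [exact: iR|exact: bR|exact: iI|exact: bI].
Qed.
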